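(* Let $\mathbf k$ be a field, let $(X,d_X)$ and $(Y,d_Y)$ be finite pseudo-metric spaces, and let $\mathbb{BB}(X)$ and $\mathbb{BB}(Y)$ be the bigraded barcodes corresponding to the persistence modules $\mathcal{PHHZ}(X)$ and $\mathcal{PHHZ}(Y)$ (bigraded persistent double homology with coefficients in $\mathbf k$), respectively. Then \[ W_\infty\bigl(\mathbb{BB}(X),\mathbb{BB}(Y)\bigr)\le 2\,d_{GH}(X,Y), \] where $W_\infty$ is the $\infty$-Wasserstein (bottleneck) distance and $d_{GH}$ is the Gromov--Hausdorff distance.
   Context: **Finite pseudo-metric spaces.** A finite pseudo-metric space is a nonempty finite set $X$ with $d_X\colon X\times X\to\mathbb R_{\ge0}$ satisfying $d_X(x,x)=0$, symmetry and the triangle inequality (distinct points may be at distance $0$). **Vietoris--Rips complex.** $R(X,t)$ ($t\ge 0$) is the clique complex of the graph with vertex set $X$ in which $x\neq y$ are joined by an edge iff $d_X(x,y)\le t$. For $t_1\le t_2$ there is an inclusion $R(X,t_1)\subset R(X,t_2)$. **Bigraded homology.** Let $K$ be a simplicial complex on a finite totally ordered vertex set $V$, $|V|=m$ (with $\varnothing\in K$ and all $\{v\}\in K$). For $J\subset V$, $K_J$ is the full subcomplex of $K$ on $J$. The bigraded homology of the moment-angle complex $\mathcal Z_K$ (coefficients in $\mathbf k$) is (Hochster decomposition) \[ H_{-i,2j}(\mathcal Z_K)=\bigoplus_{J\subset V,\ |J|=j}\widetilde H_{j-i-1}(K_J), \] where $\widetilde H_*$ is reduced simplicial homology, with $\widetilde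 H_{-1}(\varnothing)=\mathbf k$ for the empty complex. An inclusion $K\subset L$ of complexes on the same $V$ induces the direct sum of the maps $\widetilde H_*(K_J)\to\widetilde H_*(L_J)$. **Double homology.** For $J\subset V$, $v\in V\setminus J$, let $\phi_{p;J,v}\colon\widetilde H_p(K_J)\to\widetilde H_p(K_{J\cup\{v\}})$ be induced by inclusion and $\varepsilon(v,J)=(-1)^{\#\{u\in J:\,u<v\}}$. Put $\partial'_p=(-1)^{p+1}\bigoplus_{J,\,v\notin J}\varepsilon(v,J)\,\phi_{p;J,v}$. Then $(\partial')^2=0$ and $\partial'\colon H_{-i,2j}(\mathcal Z_K)\to H_{-i-1,2j+2}(\mathcal Z_K)$. The bigraded double homology is $\mathit{HH}_*(\mathcal Z_K)=H(H_*(\mathcal Z_K),\partial')$, with bigraded components $\mathit{HH}_{-i,2j}(\mathcal Z_K)$. It is functorial for inclusions of complexes on the same vertex set. **Persistence modules.** A persistence module is a functor from the poset $(\mathbb R_{\ge0},\le)$ to $\mathbf k$-modules. Direct sums are pointwise. For a finite pseudo-metric space $X$ with $|X|=m$ (fix a total order on $X$), $\mathcal{PHHZ}_{-i,2j}(X)$ is the persistence module $t\mapsto \mathit{HH}_{-i,2j}(\mathcal Z_{R(X,t)})$ with maps induced by inclusions $R(X,t_1)\subset R(X,t_2)$, and $\mathcal{PHHZ}(X)=\bigoplus_{0\le i\le m-1,\ 0\le j\le m}\mathcal{PHHZ}_{-i,2j}(X)$. **Barcodes.** For an interval $I\subset\mathbb R_{\ge0}$, the interval module $\mathbf k(I)$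 is $\mathbf k$ at $s\in I$ and $0$ otherwise, with identity maps between points of $I$ and zero maps otherwise. A pointwise finite-dimensional persistence module $\mathcal M$ over a field is a direct sum of interval modules $\bigoplus_{I\in B(\mathcal M)}\mathbf k(I)$ for a multiset $B(\mathcal M)$ of intervals, the barcode of $\mathcal M$. $\mathbb{BB}(X)$ is the barcode of $\mathcal{PHHZ}(X)$; it is a finite multiset of intervals of the form $[a,b)$, $a\in\mathbb R_{\ge 0}$, $b\in\mathbb R_{\ge 0}\cup\{\infty\}$. **Bottleneck distance.** For finite multisets $B,B'$ of such intervals let $\overline B$ be $B$ together with $|B'|$ copies of the empty interval $\varnothing$, and $\overline{B'}$ be $B'$ together with $|B|$ copies of $\varnothing$. For finite $a,b,a',b'$ set $\pi([a,b),[a',b'))=\max\{|a'-a|,|b'-b|\}$, $\pi([a,\infty),[a',\infty))=|a'-a|$, $\pi([a,b),\varnothing)=\frac{b-a}2$, $\pi(\varnothing,[a',b'))=\frac{b'-a'}2$, $\pi(\varnothing,\varnothing)=0$, and $\pi=\infty$ when exactly one of the two arguments is an infinite interval. Then $W_\infty(B,B')=\min_\theta\max_{I\in\overline B}\pi(I,\theta(I))$ over all bijections $\theta\colon\overline B\to\overline{B'}$. **Gromov--Hausdorff distance.** $d_{GH}(X,Y)=\inf_{Z,f,g}d_H(f(X),g(Y))$ over all isometric embeddings $f\colon X\to Z$, $g\colon Y\to Z$ into a pseudo-metric space $Z$, where $d_H$ is the Hausdorff distance. Equivalently, $d_{GH}(X,Y)=\frac12\min_C\max_{(x_1,y_1),(x_2,y_2)\in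 C}|d_X(x_1,x_2)-d_Y(y_1,y_2)|$ over all correspondences $C\subset X\times Y$ (subsets projecting onto both $X$ and $Y$). *)

(* Defs.v *)
From HB Require Import structures.
From mathcomp Require Import all_boot all_order all_algebra.
From mathcomp Require Import generic_quotient ring_quotient.
From mathcomp Require Import boolp.

Set Implicit Arguments.
Unset Strict Implicit.
Unset Printing Implicit Defensive.

Import Order.TTheory GRing.Theory Num.Theory.

Local Open Scope ring_scope.
Local Open Scope quotient_scope.

(* Subquotients Z / (B `&` Z) of a k-module M.  In both uses below B is
   contained in Z (bounds_cycles, dbounds_dcycles), so that this is Z / B.    *)
Record submod (k : fieldType) (M : lmodType k) (Z : submodClosed M) :=
  Submod { submod_val : M; _ : submod_val \in Z }.

Section SubmodInstances.
Variables (k : fieldType) (M : lmodType k) (Z : submodClosed M).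
HB.instance Definition _ := [isSub for @submod_val k M Z].
HB.instance Definition _ := [Choice of submod Z by <:].
HB.instance Definition _ := [SubChoice_isSubLmodule of submod Z by <:].

Lemma submod_val_linear : linear (@submod_val k M Z).
Proof. by []. Qed.
HB.instance Definition _ := GRing.isLinear.Build k (submod Z) M _
  (@submod_val k M Z) submod_val_linear.
End SubmodInstances.

Lemma submod_sub (k : fieldType) (M : lmodType k) (B : submodClosed M) x y :
  x \in B -> y \in B -> x - y \in B.
Proof. by case: (GRing.submod_closedB (submodClosedP B)) => _; apply. Qed.

Section Subquotient.
Variables (k : fieldType) (M : lmodType k) (Z B : submodClosed M).

Definition relbound : {pred submod Z} := fun x => submod_val x \in B.

Lemma relboundE x : (x \in relbound) = (submod_val x \in B).
Proof. by []. Qed.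

Lemma relbound_closed : zmod_closed relbound.
Proof.
split=> [|x y]; rewrite !relboundE; first by rewrite raddf0 rpred0.
by rewrite raddfB; exact: submod_sub.
Qed.
HB.instance Definition _ :=
  GRing.isZmodClosed.Build (submod Z) relbound relbound_closed.

Definition subquot : Type := Quotient.quot relbound.
HB.instance Definition _ := GRing.Zmodule.on subquot.

Definition subquot_class (x : submod Z) : subquot := \pi_(Quotient.quot relbound) x.

Lemma subquot_classP (x y : submod Z) :
  subquot_class x = subquot_class y <-> submod_val x - submod_val y \in B.
Proof.
split=> [/eqP|xyB]; last apply/eqP; rewrite -Quotient.idealrBE relboundE;
  by rewrite raddfB.
Qed.

Lemma subquot_class_surj (q : subquot) : {x | q = subquot_class x}.
Proof. by exists (repr q); rewrite /subquot_class reprK. Qed.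

Lemma subquot_classD x y :
  subquot_class (x + y) = subquot_class x + subquot_class y.
Proof. by rewrite /subquot_class raddfD. Qed.

Definition subquot_scale (a : k) (q : subquot) : subquot :=
  subquot_class (a *: repr q).

Lemma subquot_scaleE a x :
  subquot_scale a (subquot_class x) = subquot_class (a *: x).
Proof.
apply/subquot_classP; rewrite !linearZ /= -scalerDr rpredZ //.
by apply/subquot_classP; rewrite /subquot_class reprK.
Qed.

Lemma subquot_scaleA a b q :
  subquot_scale a (subquot_scale b q) = subquot_scale (a * b) q.
Proof. by have [x ->] := subquot_class_surj q; rewrite !subquot_scaleE scalerA. Qed.

Lemma subquot_scale1 : left_id 1 subquot_scale.
Proof. by move=> q; have [x ->] := subquot_class_surj q; rewrite subquot_scaleE scale1r. Qed.

Lemma subquot_scaleDr : right_distributive subquot_scale +%R.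
Proof.
move=> a q r; have [x ->] := subquot_class_surj q.
have [y ->] := subquot_class_surj r.
by rewrite !(subquot_scaleE, =^~ subquot_classD) scalerDr.
Qed.

Lemma subquot_scaleDl q : {morph subquot_scale^~ q : a b / a + b}.
Proof.
move=> a b; have [x ->] := subquot_class_surj q.
by rewrite !(subquot_scaleE, =^~ subquot_classD) scalerDl.
Qed.

HB.instance Definition _ := GRing.Zmodule_isLmodule.Build k subquot
  subquot_scaleA subquot_scale1 subquot_scaleDr subquot_scaleDl.

Lemma subquot_class_linear : linear subquot_class.
Proof.
by move=> a x y; rewrite subquot_classD -subquot_scaleE.
Qed.
HB.instance Definition _ := GRing.isLinear.Build k (submod Z) subquot _
  subquot_class subquot_class_linear.
End Subquotient.

Section SubquotientMap.
Variables (k : fieldType) (M M' : lmodType k).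
Variables (Z B : submodClosed M) (Z' B' : submodClosed M').

Definition submod_map (f : {linear M -> M'})
    (fZ : {homo f : x / x \in Z >-> x \in Z'}) (x : submod Z) : submod Z' :=
  Submod (fZ _ (valP x)).

Definition subquot_map (f : {linear M -> M'})
    (fZ : {homo f : x / x \in Z >-> x \in Z'})
    (fB : {homo f : x / x \in B >-> x \in B'}) (q : subquot Z B) :
    subquot Z' B' :=
  subquot_class B' (submod_map fZ (repr q)).

Variables (f : {linear M -> M'}).
Hypothesis fZ : {homo f : x / x \in Z >-> x \in Z'}.
Hypothesis fB : {homo f : x / x \in B >-> x \in B'}.

Lemma subquot_mapE x :
  subquot_map fZ fB (subquot_class B x) = subquot_class B' (submod_map fZ x).
Proof.
apply/subquot_classP; rewrite /= -raddfB; apply: fB.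
by apply/subquot_classP; rewrite /subquot_class reprK.
Qed.

Lemma subquot_map_linear : linear (subquot_map fZ fB).
Proof.
move=> a q r; have [x ->] := subquot_class_surj q.
have [y ->] := subquot_class_surj r.
rewrite -linearP !subquot_mapE -linearP /=; congr subquot_class.
by apply: val_inj; rewrite /= !linearP.
Qed.
HB.instance Definition _ := GRing.isLinear.Build k (subquot Z B)
  (subquot Z' B') _ (subquot_map fZ fB) subquot_map_linear.
End SubquotientMap.

(* Direct sum of finitely many k-modules. *)
Definition dsum (k : fieldType) (I : finType) (M : I -> lmodType k) : Type :=
  {dffun forall i : I, M i}.

Section DirectSum.
Variables (k : fieldType) (I : finType) (M : I -> lmodType k).
Implicit Types x y : dsum M.

HB.instance Definition _ := Choice.copy (dsum M) {dffun forall i : I, M i}.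

Definition dsum_mk (F : forall i, M i) : dsum M := finfun F.
Definition dsum_proj i (x : dsum M) : M i := (x : {dffun forall i, M i}) i.

Lemma dsum_mkE F i : dsum_proj i (dsum_mk F) = F i.
Proof. by rewrite /dsum_proj ffunE. Qed.

Lemma dsumP x y : (forall i, dsum_proj i x = dsum_proj i y) <-> x = y.
Proof. by split=> [xy|->//]; apply/ffunP. Qed.

Definition dsum_add x y := dsum_mk (fun i => dsum_proj i x + dsum_proj i y).
Definition dsum_opp x := dsum_mk (fun i => - dsum_proj i x).
Definition dsum_scale (a : k) x := dsum_mk (fun i => a *: dsum_proj i x).

Lemma dsum_addA : associative dsum_add.
Proof. by move=> x y z; apply/dsumP => i; rewrite !dsum_mkE addrA. Qed.
Lemma dsum_addC : commutative dsum_add.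
Proof. by move=> x y; apply/dsumP => i; rewrite !dsum_mkE addrC. Qed.
Lemma dsum_add0 : left_id (dsum_mk (fun=> 0)) dsum_add.
Proof. by move=> x; apply/dsumP => i; rewrite !dsum_mkE add0r. Qed.
Lemma dsum_addN : left_inverse (dsum_mk (fun=> 0)) dsum_opp dsum_add.
Proof. by move=> x; apply/dsumP => i; rewrite !dsum_mkE addNr. Qed.
HB.instance Definition _ := GRing.isZmodule.Build (dsum M)
  dsum_addA dsum_addC dsum_add0 dsum_addN.

Lemma dsum_scaleA a b x : dsum_scale a (dsum_scale b x) = dsum_scale (a * b) x.
Proof. by apply/dsumP => i; rewrite !dsum_mkE scalerA. Qed.
Lemma dsum_scale1 : left_id 1 dsum_scale.
Proof. by move=> x; apply/dsumP => i; rewrite !dsum_mkE scale1r. Qed.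
Lemma dsum_scaleDr : right_distributive dsum_scale +%R.
Proof. by move=> a x y; apply/dsumP => i; rewrite !dsum_mkE scalerDr. Qed.
Lemma dsum_scaleDl x : {morph dsum_scale^~ x : a b / a + b}.
Proof. by move=> a b; apply/dsumP => i; rewrite !dsum_mkE scalerDl. Qed.
HB.instance Definition _ := GRing.Zmodule_isLmodule.Build k (dsum M)
  dsum_scaleA dsum_scale1 dsum_scaleDr dsum_scaleDl.

Lemma dsum_proj_linear i : linear (@dsum_proj i).
Proof. move=> a x y; rewrite -[a *: x + y]/(dsum_add (dsum_scale a x) y).
by rewrite !dsum_mkE. Qed.
HB.instance Definition _ i := GRing.isLinear.Build k (dsum M) (M i) _
  (@dsum_proj i) (dsum_proj_linear i).
End DirectSum.

Section DirectSumMap.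
Variables (k : fieldType) (I : finType) (M N : I -> lmodType k).
Variable f : forall i, {linear M i -> N i}.

Definition dsum_map (x : dsum M) : dsum N := dsum_mk (fun i => f i (dsum_proj i x)).

Lemma dsum_map_linear : linear dsum_map.
Proof. by move=> a x y; apply/dsumP=> i; rewrite linearP /= !dsum_mkE !linearP. Qed.
HB.instance Definition _ := GRing.isLinear.Build k (dsum M) (dsum N) _
  dsum_map dsum_map_linear.
End DirectSumMap.

(* Vertices need not all be faces, so that a full subcomplex is again a complex
   on the same set V.                                                         *)
Record scomplex (V : finType) := SComplex {
  faces :> {set {set V}};
  faces0 : set0 \in faces;
  facesS : forall s t : {set V}, t \subset s -> s \in faces -> t \in faces }.

Section FullSubcomplex.
Variables (V : finType) (K L : scomplex V).

Definition full_faces (J : {set V}) : {set {set V}} :=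
  [set s in faces K | s \subset J].

Lemma full_faces0 J : set0 \in full_faces J.
Proof. by rewrite inE faces0 sub0set. Qed.

Lemma full_facesS J (s t : {set V}) :
  t \subset s -> s \in full_faces J -> t \in full_faces J.
Proof.
move=> ts; rewrite !inE => /andP[sK sJ].
by rewrite (facesS ts sK) (subset_trans ts sJ).
Qed.

Definition full J : scomplex V := SComplex (full_faces0 J) (@full_facesS J).
End FullSubcomplex.

Lemma fullS (V : finType) (K L : scomplex V) (I J : {set V}) :
  K \subset L -> I \subset J -> full K I \subset full L J.
Proof.
move=> /subsetP KL IJ; apply/subsetP => s; rewrite !inE => /andP[/KL -> sI].
exact: subset_trans sI IJ.
Qed.

Section Homology.
Variables (k : fieldType) (disp : Order.disp_t) (V : finOrderType disp).
Implicit Types (K L N : scomplex V) (p : int) (J s : {set V}) (v w : V).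

Local Notation chain := {ffun {set V} -> k^o}.

Definition sgn v s : k := (-1) ^+ #|[set u in s | (u < v)%O]|.

(* c : chain is the combination of the simplices s, oriented by the order of
   V, with coefficients c s.  The face s of s' = v |: s is obtained from s' by
   deleting its vertex number #{u in s | u < v}, whence the sign.  The empty
   simplex is included, so this is the augmented boundary.                    *)
Definition bd (c : chain) : chain :=
  [ffun s : {set V} => \sum_(v | v \notin s) sgn v s *: c (v |: s)].

Definition chains K p : {pred chain} :=
  fun c => [forall s, (c s != 0) ==> (s \in faces K) && (#|s|%:Z == p + 1)].

Definition cycles K p : {pred chain} :=
  fun c => (c \in chains K p) && (bd c == 0).

Definition bounds K p : {pred chain} :=
  fun c => `[< exists2 b, b \in chains K (p + 1) & c = bd b >].

Lemma bd_linear : linear bd.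
Proof.
move=> a b c; apply/ffunP => s; rewrite !ffunE scaler_sumr -big_split /=.
apply: eq_bigr => v _; rewrite !ffunE scalerDr !scalerA mulrC.
by rewrite -scalerA scalerA.
Qed.
HB.instance Definition _ := GRing.isLinear.Build k chain chain _ bd bd_linear.

Lemma chainsP K p (c : chain) :
  reflect (forall s, c s != 0 -> s \in faces K /\ #|s|%:Z = p + 1)
          (c \in chains K p).
Proof.
apply: (iffP forallP) => cK s.
  by move=> cs; have /andP[? /eqP] := implyP (cK s) cs.
by apply/implyP => /cK[-> /eqP].
Qed.

Lemma chains_closed K p : submod_closed (chains K p).
Proof.
split=> [|a b c /chainsP bK /chainsP cK]; apply/chainsP => s.
  by rewrite ffunE eqxx.
rewrite !ffunE; have [b0|/bK//] := eqVneq (b s) 0.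
by rewrite b0 scaler0 add0r => /cK.
Qed.

Lemma cycles_closed K p : submod_closed (cycles K p).
Proof.
have [c0 cD] := chains_closed K p; split=> [|a b c].
  by apply/andP; rewrite linear0 eqxx.
move=> /andP[bK /eqP b0] /andP[cK /eqP c0'].
by apply/andP; rewrite linearP /= b0 c0' scaler0 addr0 eqxx; split=> //; apply: cD.
Qed.

Lemma bounds_closed K p : submod_closed (bounds K p).
Proof.
have [c0 cD] := chains_closed K (p + 1); split=> [|a b c].
  by apply/asboolP; exists 0 => //; rewrite linear0.
move=> /asboolP[b' bK ->] /asboolP[c' cK ->]; apply/asboolP.
by exists (a *: b' + c'); [exact: cD | rewrite linearP].
Qed.

HB.instance Definition _ K p :=
  GRing.isSubmodClosed.Build k chain (cycles K p) (cycles_closed K p).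
HB.instance Definition _ K p :=
  GRing.isSubmodClosed.Build k chain (bounds K p) (bounds_closed K p).

Lemma sgnU v w s : v \notin s -> sgn w (v |: s) = (-1) ^+ (v < w)%O * sgn w s.
Proof.
move=> vs; rewrite /sgn -exprD; congr (_ ^+ _).
have [vw|vw] /= := boolP (v < w)%O.
  rewrite add1n -[RHS](_ : #|v |: [set u in s | (u < w)%O]| = _).
    by apply: eq_card => u; rewrite !inE; case: eqVneq => // ->; rewrite vw.
  by rewrite cardsU1 inE (negPf vs).
apply: eq_card => u; rewrite !inE; case: eqVneq => // ->.
by rewrite (negPf vw) !andbF.
Qed.

Lemma sgn_anti v w s : v \notin s -> w \notin s -> v != w ->
  sgn v s * sgn w (v |: s) = - (sgn w s * sgn v (w |: s)).
Proof.
move=> vs ws vw; rewrite !sgnU // mulrCA [sgn v s * _]mulrC.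
rewrite [sgn w s * (_ * _)]mulrCA -mulNr; congr (_ * _).
by move: vw; case: ltgtP => //= _ _; rewrite expr1 ?expr0 ?opprK.
Qed.

Lemma sum_anti (M : zmodType) (P : rel V) (F : V -> V -> M) :
    (forall v, ~~ P v v) -> symmetric P ->
    (forall v w, P v w -> F v w = - F w v) ->
  \sum_v \sum_(w | P v w) F v w = 0.
Proof.
move=> Pxx Psym Fanti.
transitivity (\sum_v \sum_(w | P v w && (v < w)%O) F v w +
              \sum_v \sum_(w | P v w && ~~ (v < w)%O) F v w).
  by rewrite -big_split; apply: eq_bigr => v _; exact: bigID.
rewrite [X in _ + X](exchange_big_dep xpredT) //= -big_split big1 // => v _ /=.
rewrite [X in _ + X](eq_bigl (fun w => P v w && (v < w)%O)) => [|w].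
  rewrite -big_split big1 // => w /andP[vw _].
  by rewrite /= (Fanti _ _ vw) addNr.
rewrite Psym; case: ltgtP => //= [] // ->.
by rewrite (negPf (Pxx _)).
Qed.

Lemma bd_bd (c : chain) : bd (bd c) = 0.
Proof.
apply/ffunP => s; rewrite !ffunE.
under eq_bigr => v vs do rewrite ffunE scaler_sumr.
rewrite big_mkcond /= -[RHS](@sum_anti k^o
  (fun v w => [&& v \notin s, w \notin s & v != w])
  (fun v w => sgn v s *: (sgn w (v |: s) *: c (w |: (v |: s))))).
- apply: eq_bigr => v _; case: ifP => vs; last by rewrite big_pred0_eq.
  by apply: eq_bigl => w; rewrite !inE negb_or andbC eq_sym.
- by move=> v; rewrite eqxx !andbF.
- by move=> v w; rewrite eq_sym andbCA.
move=> v w /and3P[vs ws vw]; rewrite !scalerA sgn_anti // scaleNr.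
by rewrite setUCA.
Qed.

Lemma bounds_cycles K p : {subset bounds K p <= cycles K p}.
Proof.
move=> _ /asboolP[b /chainsP bK ->]; apply/andP; rewrite bd_bd; split=> //.
apply/chainsP => s; rewrite ffunE => bs.
have [v vs bv] : exists2 v, v \notin s & b (v |: s) != 0.
  apply/exists_inP; apply: contraNT bs => /exists_inPn b0.
  rewrite big1 // => v /b0; rewrite negbK => /eqP ->.
  exact: scaler0.
have [vK] := bK _ bv; rewrite cardsU1 vs add1n -addn1 PoszD => /addIr sp.
by split=> //; apply: facesS vK; exact: subsetUr.
Qed.

Definition rhom K p : lmodType k := subquot (cycles K p) (bounds K p).

Section Inclusion.
Variables (K L : scomplex V) (KL : K \subset L) (p : int).

Lemma chains_incl q : {subset chains K q <= chains L q}.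
Proof.
move=> c /chainsP cK; apply/chainsP => s /cK[sK ->]; split=> //.
exact: subsetP KL _ sK.
Qed.

Lemma cycles_incl : {homo idfun : c / c \in cycles K p >-> c \in cycles L p}.
Proof. by move=> c /andP[/chains_incl cL c0]; apply/andP. Qed.

Lemma bounds_incl : {homo idfun : c / c \in bounds K p >-> c \in bounds L p}.
Proof.
by move=> c /asboolP[b /chains_incl bL ->]; apply/asboolP; exists b.
Qed.

Definition rhom_map : {linear rhom K p -> rhom L p} :=
  subquot_map cycles_incl bounds_incl.

Lemma rhom_mapE (c : submod (cycles K p)) :
  rhom_map (subquot_class (bounds K p) c) =
  subquot_class (bounds L p) (submod_map cycles_incl c).
Proof. exact: subquot_mapE. Qed.
End Inclusion.

Lemma rhom_map_id K (h : K \subset K) p x : rhom_map h p x = x.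
Proof.
have [c ->] := subquot_class_surj x; rewrite rhom_mapE; congr subquot_class.
exact: val_inj.
Qed.

Lemma rhom_map_comp K L N (KL : K \subset L) (LN : L \subset N)
    (KN : K \subset N) p x :
  rhom_map LN p (rhom_map KL p x) = rhom_map KN p x.
Proof.
have [c ->] := subquot_class_surj x; rewrite !rhom_mapE.
by congr subquot_class; apply: val_inj.
Qed.

(* The sum of the reduced homology groups of degree p of all full subcomplexes
   K_J.  Its part supported on the sets J with j elements is
   H_{-i,2j}(Z_K), where p = j - i - 1.                                       *)
Definition mahom K p : lmodType k :=
  dsum (fun J : {set V} => rhom (full K J) p).

Definition mahom_part K p (j : int) : {pred mahom K p} :=
  fun x => [forall J : {set V}, (dsum_proj J x != 0) ==> (#|J|%:Z == j)].
Arguments mahom_part : clear implicits.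

Definition phi K p J v :
    {linear rhom (full K (J :\ v)) p -> rhom (full K J) p} :=
  rhom_map (fullS (subxx (faces K)) (subD1set J v)) p.

(* Component at J of the differential: the terms with target J come from the
   sets J :\ v for v in J.                                                    *)
Definition ddiff K p (x : mahom K p) : mahom K p :=
  dsum_mk (fun J : {set V} => (-1 : k) ^ (p + 1) *:
    \sum_(v in J) sgn v (J :\ v) *: phi K p J v (dsum_proj (J :\ v) x)).

Lemma ddiff_linear K p : linear (@ddiff K p).
Proof.
move=> a x y; apply/dsumP => J; rewrite linearP /= !dsum_mkE scalerA mulrC.
rewrite -scalerA -scalerDr; congr (_ *: _).
rewrite scaler_sumr -big_split /=.
by apply: eq_bigr => v _; rewrite !linearP.
Qed.
HB.instance Definition _ K p := GRing.isLinear.Build k (mahom K p) (mahom K p) _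
  (@ddiff K p) (@ddiff_linear K p).

Definition dcycles K p j : {pred mahom K p} :=
  fun x => (x \in mahom_part K p j) && (ddiff x == 0).

Definition dbounds K p j : {pred mahom K p} :=
  fun x => `[< exists2 y, y \in mahom_part K p (j - 1) & x = ddiff y >].
Arguments dcycles : clear implicits.
Arguments dbounds : clear implicits.

Lemma mahom_partP K p j (x : mahom K p) :
  reflect (forall J, dsum_proj J x != 0 -> #|J|%:Z = j) (x \in mahom_part K p j).
Proof.
apply: (iffP forallP) => xj J; first by move=> xJ; apply/eqP/(implyP (xj J)).
by apply/implyP => /xj/eqP.
Qed.

Lemma mahom_part_closed K p j : submod_closed (mahom_part K p j).
Proof.
split=> [|a x y /mahom_partP xj /mahom_partP yj]; apply/mahom_partP => J.
  by rewrite linear0 eqxx.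
rewrite linearP /=; have [x0|/xj//] := eqVneq (dsum_proj J x) 0.
by rewrite x0 scaler0 add0r => /yj.
Qed.

Lemma dcycles_closed K p j : submod_closed (dcycles K p j).
Proof.
have [c0 cD] := mahom_part_closed K p j; split=> [|a x y].
  by apply/andP; rewrite linear0 eqxx.
move=> /andP[xj /eqP x0] /andP[yj /eqP y0]; apply/andP; split; first exact: cD.
by rewrite ddiff_linear x0 y0 scaler0 addr0.
Qed.

Lemma dbounds_closed K p j : submod_closed (dbounds K p j).
Proof.
have [c0 cD] := mahom_part_closed K p (j - 1); split=> [|a x y].
  by apply/asboolP; exists 0 => //; rewrite (linear0 (@ddiff K p)).
move=> /asboolP[x' xj ->] /asboolP[y' yj ->]; apply/asboolP.
by exists (a *: x' + y'); [exact: cD | rewrite ddiff_linear].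
Qed.

HB.instance Definition _ K p j :=
  GRing.isSubmodClosed.Build k (mahom K p) (dcycles K p j) (dcycles_closed K p j).
HB.instance Definition _ K p j :=
  GRing.isSubmodClosed.Build k (mahom K p) (dbounds K p j) (dbounds_closed K p j).

Lemma mahom_transport K L p (x : mahom K p) (I J : {set V})
    (hI : full K I \subset L) (hJ : full K J \subset L) :
  I = J -> rhom_map hI p (dsum_proj I x) = rhom_map hJ p (dsum_proj J x).
Proof. by move=> IJ; subst J; rewrite (bool_irrelevance hI hJ). Qed.

Lemma ddiff_ddiff K p (x : mahom K p) : ddiff (ddiff x) = 0.
Proof.
apply/dsumP => J; rewrite linear0 dsum_mkE.
have h v w : full K ((J :\ v) :\ w) \subset full K J.
  exact: fullS (subxx _) (subset_trans (subD1set _ _) (subD1set _ _)).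
pose F v w := sgn v (J :\ v) *: (sgn w ((J :\ v) :\ w) *:
  rhom_map (h v w) p (dsum_proj ((J :\ v) :\ w) x)).
rewrite [X in _ *: X](_ : _ = (-1) ^ (p + 1) *: \sum_v
    \sum_(w | [&& v \in J, w \in J & v != w]) F v w); last first.
  rewrite big_mkcond scaler_sumr; apply: eq_bigr => v _; case: ifP => vJ; last first.
    by rewrite big_pred0_eq scaler0.
  rewrite dsum_mkE linearZ scalerA mulrC -scalerA linear_sum scaler_sumr /=.
  congr (_ *: _); apply: eq_big => [w|w _].
    by rewrite !inE andbC eq_sym.
  rewrite linearZ /F /phi; congr (_ *: (_ *: _)); exact: rhom_map_comp.
rewrite sum_anti ?scaler0 //.
- by move=> v; rewrite eqxx !andbF.
- by move=> v w; rewrite eq_sym andbCA.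
move=> v w /and3P[vJ wJ vw]; rewrite /F !scalerA -scaleNr.
have E : J :\ w :\ v = J :\ v :\ w by rewrite !setDDl setUC.
rewrite (mahom_transport x (h w v) (h v w) E); congr (_ *: _).
rewrite E; set s := J :\ v :\ w.
have -> : J :\ v = w |: s by rewrite setD1K // !inE eq_sym vw.
have -> : J :\ w = v |: s by rewrite /s -E setD1K // !inE vw.
rewrite mulrC sgn_anti 1?mulrC // ?inE ?eqxx ?andbF // eq_sym.
exact: vw.
Qed.

Lemma dbounds_dcycles K p j : {subset dbounds K p j <= dcycles K p j}.
Proof.
move=> _ /asboolP[y /mahom_partP yj ->]; apply/andP; rewrite ddiff_ddiff; split=> //.
apply/mahom_partP => J; rewrite dsum_mkE => Jy.
have [v vJ yv] : exists2 v, v \in J & dsum_proj (J :\ v) y != 0.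
  apply/exists_inP; apply: contraNT Jy => /exists_inPn y0.
  rewrite big1 ?scaler0 // => v /y0; rewrite negbK => /eqP ->.
  by rewrite linear0 scaler0.
by rewrite (cardsD1 v) vJ add1n -addn1 PoszD (yj _ yv) subrK.
Qed.

(* HH_{-i,2j}(Z_K); as i and j grow by one under the differential, the degree
   j - i - 1 is constant along the complex.                                   *)
Definition HH K (i j : int) : lmodType k :=
  subquot (dcycles K (j - i - 1) j) (dbounds K (j - i - 1) j).

Section DoubleInclusion.
Variables (K L : scomplex V) (KL : K \subset L).

Definition mahom_map p : {linear mahom K p -> mahom L p} :=
  dsum_map (fun J => rhom_map (fullS KL (subxx J)) p).

Lemma mahom_map_part p j :
  {homo mahom_map p : x / x \in mahom_part K p j >-> x \in mahom_part L p j}.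
Proof.
move=> x /mahom_partP xj; apply/mahom_partP => J; rewrite dsum_mkE.
by have [->|/xj//] := eqVneq (dsum_proj J x) 0; rewrite linear0 eqxx.
Qed.

Lemma mahom_map_ddiff p x : mahom_map p (ddiff x) = ddiff (mahom_map p x).
Proof.
apply/dsumP => J; rewrite !dsum_mkE linearZ linear_sum /=; congr (_ *: _).
apply: eq_bigr => v _; rewrite linearZ /= dsum_mkE; congr (_ *: _).
have h : full K (J :\ v) \subset full L J by exact: fullS KL (subD1set J v).
by rewrite !(rhom_map_comp _ _ h).
Qed.

Lemma dcycles_incl p j :
  {homo mahom_map p : x / x \in dcycles K p j >-> x \in dcycles L p j}.
Proof.
move=> x /andP[xj /eqP x0]; apply/andP; split; first exact: mahom_map_part.
by rewrite -mahom_map_ddiff x0 raddf0.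
Qed.

Lemma dbounds_incl p j :
  {homo mahom_map p : x / x \in dbounds K p j >-> x \in dbounds L p j}.
Proof.
move=> _ /asboolP[y yj ->]; apply/asboolP; exists (mahom_map p y).
  exact: mahom_map_part.
by rewrite mahom_map_ddiff.
Qed.

Definition HH_map i j : {linear HH K i j -> HH L i j} :=
  subquot_map (@dcycles_incl (j - i - 1) j) (@dbounds_incl (j - i - 1) j).

Lemma HH_mapE i j (x : submod (dcycles K (j - i - 1) j)) :
  HH_map i j (subquot_class (dbounds K (j - i - 1) j) x) =
  subquot_class (dbounds L (j - i - 1) j)
    (submod_map (@dcycles_incl (j - i - 1) j) x).
Proof. exact: subquot_mapE. Qed.
End DoubleInclusion.

Lemma HH_map_id K (h : K \subset K) i j x : HH_map h i j x = x.
Proof.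
have [y ->] := subquot_class_surj x; rewrite HH_mapE; congr subquot_class.
by apply/val_inj/dsumP => J; rewrite dsum_mkE rhom_map_id.
Qed.

Lemma HH_map_comp K L N (KL : K \subset L) (LN : L \subset N)
    (KN : K \subset N) i j x :
  HH_map LN i j (HH_map KL i j x) = HH_map KN i j x.
Proof.
have [y ->] := subquot_class_surj x.
transitivity (HH_map LN i j (subquot_class _ (submod_map (@dcycles_incl _ _ KL _ _) y))).
  by congr (HH_map LN i j _); exact: HH_mapE.
apply: etrans (HH_mapE _ _) (etrans _ (esym (HH_mapE _ _))).
congr subquot_class.
apply/val_inj/dsumP => J; rewrite /= !dsum_mkE.
exact: (rhom_map_comp _ _ (fullS KN (subxx J))).
Qed.
End Homology.

From mathcomp Require Import classical_sets reals constructive_ereal ereal.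
From mathcomp Require Import interval_inference.

Section PersistenceModules.
Variables (k : fieldType) (R : realType).

Record pmod := PMod {
  pobj :> {nonneg R} -> lmodType k;
  pmap : forall s t : {nonneg R}, s <= t -> {linear pobj s -> pobj t};
  pmap_id : forall s (h : s <= s) x, pmap h x = x;
  pmap_comp : forall r s t (rs : r <= s) (st : s <= t) (rt : r <= t) x,
    pmap st (pmap rs x) = pmap rt x }.

Definition pmod_iso (M N : pmod) : Prop :=
  exists f : forall t, {linear M t -> N t},
    (forall t, bijective (f t)) /\
    (forall s t (st : s <= t) x, f t (pmap M st x) = pmap N st (f s x)).

Section Sum.
Variables (I : finType) (M : I -> pmod).

Definition psum_obj t : lmodType k := dsum (fun i => M i t).

Definition psum_map s t (st : s <= t) : {linear psum_obj s -> psum_obj t} :=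
  dsum_map (fun i => pmap (M i) st).

Lemma psum_map_id s (h : s <= s) x : psum_map h x = x.
Proof. by apply/dsumP => i; rewrite dsum_mkE pmap_id. Qed.

Lemma psum_map_comp r s t (rs : r <= s) (st : s <= t) (rt : r <= t) x :
  psum_map st (psum_map rs x) = psum_map rt x.
Proof. by apply/dsumP => i; rewrite !dsum_mkE (pmap_comp _ _ rt). Qed.

Definition psum : pmod := PMod psum_map_id psum_map_comp.
End Sum.

(* The nonempty intervals [birth, death) of nonnegative reals, death = +oo
   allowed.                                                                   *)
Record bar := Bar {
  birth : R;
  death : \bar R;
  birth_ge0 : 0 <= birth;
  birth_lt_death : (birth%:E < death)%E }.

Definition in_bar (I : bar) (t : {nonneg R}) : bool :=
  (birth I <= t%:num) && (t%:num%:E < death I)%E.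

Section IntervalModule.
Variable I : bar.

(* k if t \in I, and 0 otherwise *)
Definition ival_obj (t : {nonneg R}) : lmodType k := 'rV[k]_(in_bar I t).

(* The identity between two points of I, since pid_mx 1 : 'M_1 is 1%:M. *)
Definition ival_map (s t : {nonneg R}) (st : s <= t) :
  {linear ival_obj s -> ival_obj t} := mulmxr (pid_mx 1).

Lemma ival_map_id s (h : s <= s) x : ival_map h x = x.
Proof.
rewrite /ival_map /ival_obj /= in x *.
by case: (in_bar I s) x => x; rewrite ?pid_mx_1 ?mulmx1 // !thinmx0.
Qed.

Lemma ival_map_comp r s t (rs : r <= s) (st : s <= t) (rt : r <= t) x :
  ival_map st (ival_map rs x) = ival_map rt x.
Proof.
have conv : in_bar I r -> in_bar I t -> in_bar I s.
  move=> /andP[br _] /andP[_ td]; apply/andP; split; first exact: le_trans br rs.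
  by apply: le_lt_trans td; rewrite lee_fin.
rewrite /ival_map /ival_obj /= in x *; rewrite -mulmxA.
case: (in_bar I r) x conv => [x conv|x _]; last by rewrite (thinmx0 x) !mul0mx.
case: (in_bar I t) conv => [conv|_]; last by rewrite !thinmx0.
by rewrite conv // !pid_mx_1 !mulmx1.
Qed.

Definition ival : pmod := PMod ival_map_id ival_map_comp.
End IntervalModule.

(* The multiset of bars is given by a sequence. *)
Definition is_barcode (M : pmod) (B : seq bar) : Prop :=
  pmod_iso M (psum (fun i : 'I_(size B) => ival (tnth (in_tuple B) i))).
End PersistenceModules.

Record pseudo_metric (R : realType) (T : Type) := PseudoMetric {
  pdist :> T -> T -> R;
  pdist_ge0 : forall x y, 0 <= pdist x y;
  pdist_xx : forall x, pdist x x = 0;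
  pdist_sym : forall x y, pdist x y = pdist y x;
  pdist_triangle : forall x y z, pdist x z <= pdist x y + pdist y z }.

Section VietorisRips.
Variables (R : realType) (X : finType) (dX : pseudo_metric R X).

Definition vr_faces (t : R) : {set {set X}} :=
  [set s : {set X} | [forall x in s, forall y in s, (x != y) ==> (dX x y <= t)]].

Lemma vr_facesP t (s : {set X}) :
  reflect {in s &, forall x y, x != y -> dX x y <= t} (s \in vr_faces t).
Proof.
rewrite inE; apply: (iffP forall_inP) => st.
  by move=> x y xs ys; apply/implyP; apply: (forall_inP (st x xs)).
by move=> x xs; apply/forall_inP => y ys; apply/implyP; apply: st.
Qed.

Lemma vr_faces0 t : finset.set0 \in vr_faces t.
Proof. by apply/vr_facesP => x y; rewrite inE. Qed.

Lemma vr_facesS t (r s : {set X}) :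
  s \subset r -> r \in vr_faces t -> s \in vr_faces t.
Proof.
move=> /fintype.subsetP sr /vr_facesP rt; apply/vr_facesP => x y /sr xr /sr yr.
exact: rt.
Qed.

Definition VR t : scomplex X := SComplex (vr_faces0 t) (@vr_facesS t).

Lemma VR_sub s t : s <= t -> VR s \subset VR t.
Proof.
move=> st; apply/fintype.subsetP => r /vr_facesP rs; apply/vr_facesP => x y xr yr xy.
exact: le_trans (rs x y xr yr xy) st.
Qed.
End VietorisRips.

Section PersistentDoubleHomology.
Variables (k : fieldType) (R : realType) (disp : Order.disp_t).
Variables (X : finOrderType disp) (dX : pseudo_metric R X).

Section Bidegree.
Variables i j : int.

Definition phh_obj (t : {nonneg R}) : lmodType k := HH k (VR dX t%:num) i j.

Definition phh_map (s t : {nonneg R}) (st : s <= t) :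
  {linear phh_obj s -> phh_obj t} := HH_map k (VR_sub dX st) i j.

Lemma phh_map_id s (h : s <= s) x : phh_map h x = x.
Proof. exact: HH_map_id. Qed.

Lemma phh_map_comp r s t (rs : r <= s) (st : s <= t) (rt : r <= t) x :
  phh_map st (phh_map rs x) = phh_map rt x.
Proof. exact: HH_map_comp. Qed.

(* PHHZ_{-i,2j}(X) *)
Definition PHHZij : pmod k R := PMod phh_map_id phh_map_comp.
End Bidegree.

Definition PHHZ : pmod k R :=
  psum (fun ij : 'I_#|X| * 'I_#|X|.+1 => PHHZij ij.1%:Z ij.2%:Z).
End PersistentDoubleHomology.

Section Bottleneck.
Variable R : realType.
Local Open Scope ereal_scope.

(* In both definitions the case death = -oo does not occur. *)
Definition bar_cost (I J : bar R) : \bar R :=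
  match death I, death J with
  | b%:E, b'%:E => (Num.max `|birth J - birth I| `|b' - b|)%R%:E
  | +oo, +oo => `|birth J - birth I|%R%:E
  | _, _ => +oo
  end.

Definition bar_cost0 (I : bar R) : \bar R :=
  if death I is b%:E then ((b - birth I) / 2)%R%:E else +oo.

(* None stands for the empty interval. *)
Definition cost (I J : option (bar R)) : \bar R :=
  match I, J with
  | Some I', Some J' => bar_cost I' J'
  | Some I', None | None, Some I' => bar_cost0 I'
  | None, None => 0
  end.

(* Elements of a multiset are positions in the sequence, so that bijections of
   multisets are bijections of positions.                                     *)
Definition pad (B B' : seq (bar R)) : seq (option (bar R)) :=
  map Some B ++ nseq (size B') None.

Definition bottleneck (B B' : seq (bar R)) : \bar R :=
  \big[Order.min/+oo]_(theta : {ffun 'I_(size (pad B B')) -> 'I_(size (pad B' B))}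
                      | `[< bijective theta >])
   \big[Order.max/0]_(i < size (pad B B'))
     cost (tnth (in_tuple (pad B B')) i) (tnth (in_tuple (pad B' B)) (theta i)).
End Bottleneck.

Section GromovHausdorff.
Variable R : realType.
Local Open Scope classical_set_scope.
Local Open Scope ereal_scope.

Definition hausdorff (T : Type) (d : pseudo_metric R T) (A B : set T) : \bar R :=
  Order.max (ereal_sup [set ereal_inf [set (d a b)%:E | b in B] | a in A])
            (ereal_sup [set ereal_inf [set (d a b)%:E | a in A] | b in B]).

Definition isometric (S T : Type) (dS : pseudo_metric R S) (dT : pseudo_metric R T)
  (f : S -> T) : Prop := forall x y, dT (f x) (f y) = dS x y.

Definition gromov_hausdorff (X Y : Type) (dX : pseudo_metric R X)
    (dY : pseudo_metric R Y) : \bar R :=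
  ereal_inf [set r | exists (Z : Type) (dZ : pseudo_metric R Z) (f : X -> Z)
      (g : Y -> Z), [/\ isometric dX dZ f, isometric dY dZ g
                      & r = hausdorff dZ (range f) (range g)]].
End GromovHausdorff.

(* Main.v *)
(* By stability of barcodes it is enough to interleave PHHZ(X) and PHHZ(Y) with
   parameter 2 d_GH(X, Y).  A correspondence C between X and Y with distortion at
   most e carries two pseudo-metrics, pulled back from X and from Y; they differ by
   at most e, so that the double homologies of their Vietoris-Rips complexes are
   e-interleaved by inclusions.  It remains to see that double homology does not
   change when a complex is pulled back along a surjection of vertex sets, i.e.
   when points are doubled.  If z is a double of v, the map from the homology of
   K_J to that of K_(J + v) is an isomorphism for every J containing z; hence the
   part of the double complex supported on the sets J that are not contained in a
   chosen set of representatives is acyclic, and the quotient by it is the double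
   complex of the original vertex set.

   Algebraic stability follows Bjerkevik.  Write an e-interleaving as two matrices
   between the bars.  Restricted to long bars (length > 2e), listed by
   birth + death, the product of the two matrices is unitriangular and only
   involves bars that are e-close to one of the given ones.  Comparing ranks gives
   the marriage condition for the padded multisets, and Hall's theorem yields the
   bijection. *)
Require Import Defs.
From HB Require Import structures.
From mathcomp Require Import all_boot all_order all_algebra.
From mathcomp Require Import boolp lra.

Set Implicit Arguments.
Unset Strict Implicit.
Unset Printing Implicit Defensive.

Import Order.TTheory GRing.Theory Num.Theory.
Local Open Scope ring_scope.

(** * Homology and doubled vertices *)

Section Subquotients.
Variables (k : fieldType) (M M' : lmodType k).
Variables (Z B : submodClosed M) (Z' B' : submodClosed M').
Variables (f : {linear M -> M'}).
Hypothesis fZ : {homo f : x / x \in Z >-> x \in Z'}.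
Hypothesis fB : {homo f : x / x \in B >-> x \in B'}.

Lemma subquot_map_injective :
  (forall x, x \in Z -> f x \in B' -> x \in B) -> injective (subquot_map fZ fB).
Proof.
move=> fBinv q r; have [x ->] := subquot_class_surj q.
have [y ->] := subquot_class_surj r.
rewrite !subquot_mapE => /subquot_classP /=; rewrite -linearB => fxy.
apply/subquot_classP; apply: fBinv fxy.
exact: (submod_sub (valP x) (valP y)).
Qed.

Lemma subquot_map_surjective :
  (forall y, y \in Z' -> exists2 x, x \in Z & f x - y \in B') ->
  forall q, exists r, subquot_map fZ fB r = q.
Proof.
move=> fsurj q; have [y ->] := subquot_class_surj q.
have [x xZ fxy] := fsurj _ (valP y).
by exists (subquot_class B (Submod xZ)); rewrite subquot_mapE; apply/subquot_classP.
Qed.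
End Subquotients.

(** * Cones and dominated vertices *)

Section Cone.
Variables (k : fieldType) (disp : Order.disp_t) (V : finOrderType disp).
Implicit Types (K L : scomplex V) (p : int) (I J s : {set V}) (v w z : V).
Local Notation chain := {ffun {set V} -> k^o}.

Lemma sgn_sqr v s : sgn k v s * sgn k v s = 1.
Proof. by rewrite /sgn -expr2 sqrr_sign. Qed.

(** The signed join with [z], which kills simplices already containing [z]; a contracting homotopy
    for the augmented chains of the full simplex. *)
Definition cone z (c : chain) : chain :=
  [ffun s : {set V} => if z \in s then sgn k z (s :\ z) *: c (s :\ z) else 0].

(** At [s] without [z] only the term [v = z] of the boundary survives and gives [c s] back. At [s]
    containing [z], [cone z (bd c)] contributes [c s], and the remaining terms cancel by
    [sgn_anti]. *)
Lemma bd_cone z (c : chain) : bd (cone z c) = c - cone z (bd c).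
Proof.
apply/eqP; rewrite eq_sym subr_eq eq_sym; apply/eqP/ffunP => s.
rewrite ffunE [bd _ s]ffunE [cone z (bd c) s]ffunE.
have [zs|zs] := boolP (z \in s); last first.
  rewrite addr0 (bigD1 z) //= ffunE setU11 setU1K // scalerA sgn_sqr scale1r.
  rewrite big1 ?addr0 // => v /andP[vs vz]; rewrite ffunE in_setU1 eq_sym.
  by rewrite (negPf vz) (negPf zs) scaler0.
set r := s :\ z; have zr : z \notin r by rewrite setD11.
have {zs}-> : s = z |: r by rewrite setD1K.
have -> : bd c r = sgn k z r *: c (z |: r) +
    \sum_(v | (v \notin r) && (v != z)) sgn k v r *: c (v |: r).
  by rewrite ffunE (bigD1 z).
rewrite scalerDr scalerA sgn_sqr scale1r addrCA scaler_sumr.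
rewrite (eq_bigl (fun v => (v \notin r) && (v != z))) => [|v]; last first.
  by rewrite in_setU1 negb_or andbC.
rewrite -big_split big1 ?addr0 // => v /andP[vr vz] /=.
rewrite ffunE !in_setU1 eqxx /= orbT.
have -> : (v |: (z |: r)) :\ z = v |: r.
  by rewrite setUCA setU1K // in_setU1 eq_sym negb_or vz.
rewrite !scalerA -scalerDl.
have := sgn_anti k zr vr; rewrite eq_sym => /(_ vz) E.
have -> : sgn k z (v |: r) = - (sgn k v r * sgn k z r * sgn k v (z |: r)).
  by rewrite -mulrA E mulrN opprK mulrA sgn_sqr mul1r.
by rewrite mulrN mulrCA sgn_sqr mulr1 mulrC addNr scale0r.
Qed.

Lemma chains_bd K q (c : chain) : c \in chains K (q + 1) -> bd c \in chains K q.
Proof.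
move=> cK; have /bounds_cycles/andP[] // : bd c \in bounds (k := k) K q.
by apply/asboolP; exists c.
Qed.

(** Domination as in strong collapses: for a vertex [v != z], the link of [v] is a cone with apex
    [z]. *)
Definition dominated K v z := forall s, s \in faces K -> v \in s -> z |: s \in faces K.

Section Dominated.
Variables (K : scomplex V) (I : {set V}) (v z : V).
Hypotheses (zI : z \in I) (vI : v \notin I) (dom : dominated K v z).

Let vz : v != z. Proof. by apply: contraNneq vI => ->. Qed.

Lemma chains_full J q (c : chain) :
  c \in chains (full K J) q <->
  c \in chains K q /\ forall s, ~~ (s \subset J) -> c s = 0.
Proof.
split=> [/chainsP cK|[/chainsP cK c0]].
  split; first by apply/chainsP => s /cK[]; rewrite inE => /andP[].
  move=> s sJ; apply/eqP; apply: contraNT sJ => /cK[].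
  by rewrite inE => /andP[].
apply/chainsP => s cs; have [sK sq] := cK s cs; split=> //; rewrite inE sK.
by apply: contraNT cs => /c0 ->.
Qed.

Definition star_part (c : chain) : chain := [ffun s : {set V} => if v \in s then c s else 0].

(** The boundary at a simplex containing [v] only reads larger simplices, which contain [v] too. *)
Lemma star_bd (c : chain) : (forall s, v \in s -> bd c s = 0) ->
  forall s, v \in s -> bd (star_part c) s = 0.
Proof.
move=> c0 s vs; rewrite -[RHS](c0 s vs) !ffunE; apply: eq_bigr => w _.
by rewrite ffunE in_setU1 vs orbT.
Qed.

(** Domination keeps the joined simplices in [K], and [z \in I] keeps them over [v |: I]. *)
Lemma cone_star_chains q (c : chain) : c \in chains (full K (v |: I)) q ->
  cone z (star_part c) \in chains (full K (v |: I)) (q + 1).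
Proof.
move=> /chainsP cK; apply/chainsP => s; rewrite ffunE.
case: ifP => zs; last by rewrite eqxx.
rewrite ffunE; case: ifP => vs; last by rewrite scaler0 eqxx.
move=> cs; have [|]:= cK (s :\ z); first by apply: contraNneq cs => ->; rewrite scaler0.
rewrite inE => /andP[sK sI] sq.
split; last by rewrite (cardsD1 z) zs add1n -addn1 PoszD sq.
have := dom sK vs; rewrite setD1K // inE => -> /=.
rewrite -(setD1K zs) subUset sI andbT sub1set in_setU1 zI orbT.
by [].
Qed.

(* Adding z to the simplices that contain v pushes a chain off the star of v. *)
Lemma unstar_chains q (c : chain) : c \in chains (full K (v |: I)) q ->
    (forall s, v \in s -> bd c s = 0) ->
  c - bd (cone z (star_part c)) \in chains (full K I) q.
Proof.
move=> cK c0; have cs := cone_star_chains cK.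
have /chains_full[dK d0] : c - bd (cone z (star_part c)) \in chains (full K (v |: I)) q.
  by have [C0 CD] := chains_closed k (full K (v |: I)) q;
     rewrite addrC -scaleN1r; apply: CD => //; apply: chains_bd.
apply/chains_full; split=> // s sI.
have [svI|/d0//] := boolP (s \subset v |: I).
have vs : v \in s.
  apply: contraNT sI => vs; apply/subsetP => u us.
  have := subsetP svI u us; rewrite in_setU1 => /predU1P[uv|//].
  by rewrite -uv us in vs.
(* By [bd_cone] the chain is [c] minus its star part plus the cone on the boundary of the star part.
   At [s] containing [v] the first two cancel; the third is read at [s :\ z], which still contains
   [v]. *)
rewrite bd_cone opprB addrCA ffunE [cone _ _ s]ffunE [in X in _ + X]ffunE.
rewrite [(- _ : chain) s]ffunE [star_part c s]ffunE vs subrr addr0.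
case: ifP => zs //; rewrite star_bd ?scaler0 // in_setD1 vz vs //.
Qed.

Variables (p : int) (h : full K I \subset full K (v |: I)).

(** A chain over [v |: I] bounding a cycle over [I] has zero boundary on the star of [v], so it can
    be pushed off that star without changing its boundary. *)
Lemma rhom_dominated_inj : injective (rhom_map k h p).
Proof.
apply: subquot_map_injective => c /andP[/chains_full[_ c0] _] /asboolP[b bK cb]; apply/asboolP.
exists (b - bd (cone z (star_part b))); last by rewrite linearB /= bd_bd subr0.
by apply: unstar_chains => // s vs; rewrite -cb c0 //;
  apply: contra vI => /subsetP; apply.
Qed.

(** Pushing a cycle off the star of [v] changes it by a boundary. *)
Lemma rhom_dominated_surj y : exists x, rhom_map k h p x = y.
Proof.
apply: subquot_map_surjective => c /andP[cK /eqP c0].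
exists (c - bd (cone z (star_part c))).
  apply/andP; split; last by rewrite linearB /= bd_bd subr0 c0.
  by apply: unstar_chains => // s _; rewrite c0 ffunE.
rewrite /= addrAC subrr add0r -scaleN1r; apply: rpredZ; apply/asboolP.
by exists (cone z (star_part c)); [exact: cone_star_chains|].
Qed.
End Dominated.
End Cone.

Lemma dependent_choice (A : Type) (B : A -> Type) (P : forall a, B a -> Prop) :
  (forall a, exists b, P a b) -> exists f : forall a, B a, forall a, P a (f a).
Proof. by move=> PP; exists (fun a => projT1 (cid (PP a))) => a; case: cid. Qed.

(** * Acyclicity of the part of the double complex off a set of representatives *)

Section Acyclic.
Variables (k : fieldType) (disp : Order.disp_t) (V : finOrderType disp).
Variables (K : scomplex V) (p : int).
Implicit Types (I J W : {set V}) (v w z : V) (x y : mahom k K p) (j : int).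

(** The subcomplex spanned by the sets not contained in [W]; it is stable because the differential
    at [J] only reads subsets of [J]. *)
Definition vanishes_on W x := forall J, J \subset W -> dsum_proj J x = 0.

Lemma vanishes_onS W W' x : W \subset W' -> vanishes_on W' x -> vanishes_on W x.
Proof. by move=> WW' x0 J JW; apply: x0; apply: subset_trans WW'. Qed.

Lemma vanishes_onD W x y :
  vanishes_on W x -> vanishes_on W y -> vanishes_on W (x + y).
Proof. by move=> x0 y0 J JW; rewrite linearD /= x0 // y0 // addr0. Qed.

Lemma ddiffE x J : dsum_proj J (ddiff x) = (-1 : k) ^ (p + 1) *:
    \sum_(v in J) sgn k v (J :\ v) *: phi k K p J v (dsum_proj (J :\ v) x).
Proof. exact: dsum_mkE. Qed.

Lemma vanishes_on_ddiff W x : vanishes_on W x -> vanishes_on W (ddiff x).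
Proof.
move=> x0 J JW; rewrite ddiffE big1 ?scaler0 // => v _.
by rewrite x0 ?linear0 ?scaler0 //; apply: subset_trans JW; exact: subD1set.
Qed.

Lemma mahom_partD j x y : x \in mahom_part j -> y \in mahom_part j ->
  x + y \in mahom_part j.
Proof. by case: (mahom_part_closed k K p j) => _ /(_ 1 x y); rewrite scale1r. Qed.

Lemma mahom_partB j x y : x \in mahom_part j -> y \in mahom_part j ->
  x - y \in mahom_part j.
Proof.
by move=> xj yj; case: (mahom_part_closed k K p j) => _ /(_ (-1) y x);
   rewrite scaleN1r addrC; apply.
Qed.

Lemma ddiff_part j y : y \in mahom_part (j - 1) -> ddiff y \in mahom_part j.
Proof.
move=> yj; have : ddiff y \in dbounds j by apply/asboolP; exists y.
by move/dbounds_dcycles/andP => [].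
Qed.

Lemma scaler_eq0_unit (u : k) (M : lmodType k) (m : M) :
  u != 0 -> u *: m = 0 -> m = 0.
Proof. by move=> u0 /eqP; rewrite scaler_eq0 (negPf u0) => /eqP. Qed.

Lemma sgn_neq0 v I : sgn k v I != 0.
Proof. by rewrite /sgn signr_eq0. Qed.

Lemma expN1_neq0 (q : int) : (-1 : k) ^ q != 0.
Proof. by rewrite expfz_neq0 // oppr_eq0 oner_eq0. Qed.

(* The components of x at the sets J containing v and z are killed by preimages
   of them at J :\ v; the components of the resulting cycle at the sets that
   contain z but not v then vanish because adding v is injective on them. *)
Lemma vanishes_on_step W v z x j : v \in W -> z \notin W -> dominated K v z ->
    x \in mahom_part j -> ddiff x = 0 -> vanishes_on W x ->
  exists y, [/\ y \in mahom_part (j - 1), vanishes_on W y &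
             vanishes_on (z |: W) (x - ddiff y)].
Proof.
move=> vW zW dom xj x0 xW.
(* The sets where adding [v] is an isomorphism by domination; preimages are chosen only there. *)
pose good I := [&& z \in I, v \notin I & I \subset z |: W].
pose u I := (-1 : k) ^ (p + 1) * sgn k v I.
have u0 I : u I != 0 by rewrite mulf_neq0 ?expN1_neq0 ?sgn_neq0.
(* Quantifying over [J = v |: I] avoids casts between homology types. The clause giving [m = 0]
   keeps the preimage in degree [j - 1]. *)
pose spec I (m : rhom k (full K I) p) :=
  if good I then forall J (h : full K I \subset full K J), J = v |: I ->
    u I *: rhom_map k h p m = dsum_proj J x /\ (dsum_proj J x = 0 -> m = 0)
  else m = 0.
have /dependent_choice [y yP] : forall I, exists m, spec I m.
  move=> I; rewrite /spec; case: (boolP (good I)) => [/and3P[zI vI _]|_]; last by exists 0.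
  have h : full K I \subset full K (v |: I).
    exact: fullS (subxx _) (subsetUr _ _).
  have [y yE] := rhom_dominated_surj zI vI dom h ((u I)^-1 *: dsum_proj (v |: I) x).
  exists y => J h' JE; subst J; rewrite (bool_irrelevance h' h) yE.
  rewrite scalerA mulfV // scale1r; split=> // E.
  apply: (rhom_dominated_inj zI vI dom (h := h)).
  by rewrite yE E scaler0 linear0.
have ygood I : good I -> forall J (h : full K I \subset full K J), J = v |: I ->
    u I *: rhom_map k h p (y I) = dsum_proj J x /\ (dsum_proj J x = 0 -> y I = 0).
  by have := yP I; rewrite /spec; case: (good I).
have ybad I : ~~ good I -> y I = 0 by have := yP I; rewrite /spec; case: (good I).
pose y' : mahom k K p := dsum_mk y.
have y'W : vanishes_on W y'.
  move=> J JW; rewrite dsum_mkE ybad // /good negb_and.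
  by apply/orP; left; apply: contra zW; apply: (subsetP JW).
have DW : vanishes_on W (x - ddiff y').
  by move=> J JW; rewrite linearB /= xW // (vanishes_on_ddiff y'W) // subrr.
exists y'; split=> //.
  apply/mahom_partP => J; rewrite dsum_mkE => yJ.
  have gJ : good J by apply: contraNT yJ => /ybad ->.
  have h : full K J \subset full K (v |: J) by exact: fullS (subxx _) (subsetUr _ _).
  have [_ yx] := ygood J gJ _ h erefl.
  have /(mahom_partP _ _ xj) <- : dsum_proj (v |: J) x != 0.
    by apply: contraNneq yJ => /yx ->.
  by case/and3P: gJ => _ vJ _; rewrite cardsU1 vJ add1n -addn1 PoszD addrK.
(* For [w != v] the set [J :\ w] still contains [v] and is not good, so only the term at [v]
   remains, and it was chosen to cancel [x]. *)
have full_case J : v \in J -> z \in J -> J \subset z |: W ->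
    dsum_proj J (x - ddiff y') = 0.
  move=> vJ zJ JW; rewrite linearB /= ddiffE (bigD1 v) //=.
  have vz : z != v by apply: contraNneq zW => ->.
  rewrite big1 ?addr0 => [|w /andP[wJ wv]]; last first.
    rewrite dsum_mkE ybad ?linear0 ?scaler0 // /good !inE (eq_sym v) wv vJ.
    by rewrite andbF.
  have gJ : good (J :\ v).
    by rewrite /good !inE vz zJ eqxx /= (subset_trans (subD1set _ _) JW).
  have [E _] := ygood _ gJ J (fullS (subxx _) (subD1set J v)) (esym (setD1K vJ)).
  by rewrite dsum_mkE scalerA -/(u _) E subrr.
move=> J JW; have [zJ|zJ] := boolP (z \in J); last first.
  apply: DW; apply/subsetP => w wJ; have := subsetP JW w wJ.
  by rewrite in_setU1 => /predU1P[wz|//]; rewrite -wz wJ in zJ.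
have [vJ|vJ] := boolP (v \in J); first exact: full_case.
(* Here the term at [z] vanishes because its set lies in [W], and those at other [w != v] vanish by
   [full_case]; so the component at [J] is killed by the injective map adding [v]. *)
have : dsum_proj (v |: J) (ddiff (x - ddiff y')) = 0.
  by rewrite [ddiff _](linearB (@ddiff k disp V K p)) /= x0 ddiff_ddiff subrr linear0.
rewrite ddiffE => /(scaler_eq0_unit (expN1_neq0 _)).
rewrite (bigD1 v) ?setU11 //= big1 ?addr0 => [|w /andP[wJ wv]]; last first.
  rewrite (_ : dsum_proj _ _ = 0) ?linear0 ?scaler0 //.
  have JvW : (v |: J) :\ w \subset z |: W.
    apply: subset_trans (subD1set _ _) _.
    by rewrite subUset JW sub1set in_setU1 vW orbT.
  have [wz|wz] := eqVneq w z; last first.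
    by apply: full_case; rewrite // !inE ?eqxx ?zJ ?orbT ?andbT eq_sym.
  apply: DW; apply/subsetP => t tJ; have := subsetP JvW t tJ.
  by rewrite in_setU1 => /predU1P[tz|//]; move: tJ; rewrite tz wz setD11.
move=> /(scaler_eq0_unit (sgn_neq0 _ _)) E.
have h : full K J \subset full K (v |: J) by exact: fullS (subxx _) (subsetUr _ _).
apply: (rhom_dominated_inj zJ vJ dom (h := h)); rewrite linear0 -[RHS]E.
by apply: mahom_transport; rewrite setU1K.
Qed.

(** Induction on the number of vertices outside [W]: each such [z] is absorbed by [vanishes_on_step]
    with [v = r z], and an element vanishing on all sets is zero. *)
Lemma vanishes_on_acyclic W (r : V -> V) x j :
    (forall z, r z \in W) -> (forall z, dominated K (r z) z) ->
    x \in mahom_part j -> ddiff x = 0 -> vanishes_on W x ->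
  exists y, [/\ y \in mahom_part (j - 1), vanishes_on W y & ddiff y = x].
Proof.
have [n] := ubnP #|~: W|; elim: n => // n IH in W x *; rewrite ltnS => Wn rW dom xj x0 xW.
have [z zW|Wfull] := pickP (fun z => z \notin W); last first.
  exists 0; split; first by have [] := mahom_part_closed k K p (j - 1).
    by move=> J _; rewrite linear0.
  rewrite (linear0 (@ddiff k disp V K p)); apply/esym/dsumP => J; rewrite linear0 xW //.
  by apply/subsetP => t _; apply/negPn; rewrite Wfull.
have [y [yj yW DW]] := vanishes_on_step (rW z) zW (dom z) xj x0 xW.
have [||||||y' [yj' yW' E]] := IH (z |: W) (x - ddiff y) => //.
- apply: leq_trans Wn; rewrite [leqRHS](cardsD1 z) inE zW add1n ltnS.
  by apply/subset_leq_card/subsetP => t; rewrite !inE negb_or.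
- by move=> t; rewrite in_setU1 rW orbT.
- by apply: mahom_partB => //; apply: ddiff_part.
- by rewrite [ddiff _](linearB (@ddiff k disp V K p)) /= x0 ddiff_ddiff subrr.
exists (y + y'); split; first exact: mahom_partD.
  by apply: vanishes_onD => //; apply: vanishes_onS yW'; exact: subsetUr.
by rewrite [LHS](linearD (@ddiff k disp V K p)) /= E addrC subrK.
Qed.
End Acyclic.

(** * Change of the vertex set *)

Lemma sgnE (k : fieldType) (disp : Order.disp_t) (V : finOrderType disp) (u : V) (s : {set V}) :
  sgn k u s = \prod_(v in s) (-1) ^+ (v < u)%O.
Proof.
rewrite /sgn -prodr_const (eq_bigl (fun v => (v \in s) && (v < u)%O)).
  by rewrite big_mkcondr; apply: eq_bigr => v _; case: ifP.
by move=> v; rewrite inE.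
Qed.

Section Pullback.
Variables (k : fieldType) (disp disp' : Order.disp_t).
Variables (V : finOrderType disp) (V' : finOrderType disp').
Variables (sigma : V -> V') (sigma_inj : injective sigma).
Implicit Types (I J s : {set V}) (A B t : {set V'}) (v w : V) (p q : int).
Local Notation chain := {ffun {set V} -> k^o}.
Local Notation chain' := {ffun {set V'} -> k^o}.

Definition inv_sgn v w : k := (-1) ^+ ((v < w)%O && (sigma w < sigma v)%O).

(* The sign of the permutation sorting sigma @: s, for s in increasing order. *)
Definition reorder_sgn s : k := \prod_(v in s) \prod_(w in s) inv_sgn v w.

(** The new inversions pair [v] with the elements of [s] whose position relative to [v] is changed
    by [sigma]; these are the elements on which the two position signs differ. *)
Lemma reorder_sgnU v s : v \notin s ->
  sgn k v s * reorder_sgn (v |: s) = sgn k (sigma v) (sigma @: s) * reorder_sgn s.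
Proof.
move=> vs; rewrite /reorder_sgn big_setU1 //= big_setU1 //=.
under [X in _ * (_ * X)]eq_bigr => u _ do rewrite big_setU1 //=.
rewrite big_split /= {1}/inv_sgn ltxx mul1r !mulrA; congr (_ * _).
rewrite !sgnE big_imset /=; last by move=> x y _ _; apply: sigma_inj.
rewrite -!big_split; apply: eq_bigr => u us /=.
have uv : u != v by apply: contraNneq vs => <-.
have suv : sigma u != sigma v by rewrite inj_eq.
rewrite /inv_sgn; move: suv uv.
case: (ltgtP (sigma u)) => // _ _; case: (ltgtP u) => // _ _ /=;
by rewrite !(expr1, expr0, mulr1, mul1r, mulrNN).
Qed.

Lemma reorder_sgn_sqr s : reorder_sgn s * reorder_sgn s = 1.
Proof.
rewrite -!big_split big1 // => v _; rewrite -big_split big1 // => w _ /=.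
by rewrite /inv_sgn -expr2 sqrr_sign.
Qed.

Lemma reorder_sgn_neq0 s : reorder_sgn s != 0.
Proof.
apply/eqP => E; have := reorder_sgn_sqr s; rewrite E mul0r => /eqP.
by rewrite eq_sym oner_eq0.
Qed.

Definition pullc (c : chain') : chain :=
  [ffun s : {set V} => reorder_sgn s *: c (sigma @: s)].

Lemma pullc_linear : linear pullc.
Proof. by move=> a b c; apply/ffunP => s; rewrite !ffunE scalerDr !scalerA mulrC. Qed.
HB.instance Definition _ :=
  GRing.isLinear.Build k chain' chain _ pullc pullc_linear.

Definition carried (c : chain') J := forall t, ~~ (t \subset sigma @: J) -> c t = 0.

Lemma carried_bd c J : carried c J -> carried (bd c) J.
Proof.
move=> cJ t tJ; rewrite ffunE big1 // => v _; rewrite cJ ?scaler0 //.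
by apply: contra tJ; apply: subset_trans; exact: subsetUr.
Qed.

Lemma imset_subE s J : (sigma @: s \subset sigma @: J) = (s \subset J).
Proof.
apply/idP/idP => [/subsetP sJ|]; last exact: imsetS.
apply/subsetP => v vs; have := sJ _ (imset_f sigma vs).
by rewrite mem_imset.
Qed.

Lemma imset_preimset t J : t \subset sigma @: J -> sigma @: (sigma @^-1: t) = t.
Proof.
move=> /subsetP tJ; apply/setP => w; apply/imsetP/idP => [[v]|wt].
  by rewrite inE => vt ->.
by have /imsetP[v _ E] := tJ w wt; exists v => //; rewrite inE -E.
Qed.

Lemma pullc_inj c J : carried c J -> pullc c = 0 -> c = 0.
Proof.
move=> cJ c0; apply/ffunP => t; rewrite [RHS]ffunE.
have [/imset_preimset <-|/cJ //] := boolP (t \subset sigma @: J).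
have /ffunP/(_ (sigma @^-1: t)) := c0; rewrite !ffunE => /eqP.
by rewrite scaler_eq0 (negPf (reorder_sgn_neq0 _)) => /eqP.
Qed.

(** Being carried by the image discards the terms of [bd c] that add a vertex outside the image; on
    the others the signs agree by [reorder_sgnU]. *)
Lemma bd_pullc c J : carried c J -> bd (pullc c) = pullc (bd c).
Proof.
move=> cJ; apply/ffunP => s; rewrite ffunE [RHS]ffunE [bd c _]ffunE.
rewrite [in RHS](bigID (mem (sigma @: ~: s))) /=.
rewrite [X in _ + X]big1 => [|v' /andP[v's v'n]]; last first.
  rewrite cJ ?scaler0 // subUset sub1set negb_and; apply/orP; left.
  apply: contra v'n => /imsetP[v _ vE]; rewrite vE mem_imset // inE.
  by apply: contra v's => vs; rewrite vE imset_f.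
rewrite addr0 (eq_bigl (mem (sigma @: ~: s))) => [|v' /=]; last first.
  apply: andb_idl => /imsetP[v vs ->]; rewrite mem_imset //.
  by rewrite inE in vs.
rewrite big_imset /=; last by move=> x y _ _; apply: sigma_inj.
rewrite scaler_sumr; apply: eq_big => [v|v vs]; first by rewrite inE.
by rewrite ffunE imsetU1 !scalerA reorder_sgnU // [_ * sgn _ _ _]mulrC.
Qed.

Section Faces.
Variables (K : scomplex V) (K' : scomplex V').
Hypothesis facesK : forall s, (sigma @: s \in faces K') = (s \in faces K).

Lemma chains_carried A J q c :
  A \subset sigma @: J -> c \in chains (full K' A) q -> carried c J.
Proof.
move=> AJ /chains_full[_ c0] t tJ; apply: c0.
by apply: contra tJ => tI; apply: subset_trans AJ.
Qed.

Lemma pullc_chains A J q c : A \subset sigma @: J ->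
  c \in chains (full K' A) q -> pullc c \in chains (full K J) q.
Proof.
move=> AJ /chainsP cK; apply/chainsP => s; rewrite ffunE => cs.
have [|sK sq] := cK (sigma @: s).
  by apply: contraNneq cs => ->; rewrite scaler0.
move: sK; rewrite !inE facesK => /andP[-> sI]; split.
  by rewrite -imset_subE; apply: subset_trans AJ.
by rewrite -sq card_imset.
Qed.

Lemma pullc_cycles A J p : A \subset sigma @: J ->
  {homo pullc : c / c \in cycles (full K' A) p >-> c \in cycles (full K J) p}.
Proof.
move=> AJ c /andP[cK /eqP c0]; apply/andP; split; first exact: pullc_chains cK.
by rewrite (bd_pullc (chains_carried AJ cK)) c0 linear0.
Qed.

Lemma pullc_bounds A J p : A \subset sigma @: J ->
  {homo pullc : c / c \in bounds (full K' A) p >-> c \in bounds (full K J) p}.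
Proof.
move=> AJ _ /asboolP[b bK ->]; apply/asboolP.
exists (pullc b); first exact: pullc_chains bK.
by rewrite (bd_pullc (chains_carried AJ bK)).
Qed.

Lemma pullc_surj J q b : b \in chains (full K J) q ->
  exists2 c, c \in chains (full K' (sigma @: J)) q & pullc c = b.
Proof.
move=> /chainsP bK; pose pre t := sigma @^-1: t.
have preK s : pre (sigma @: s) = s.
  by apply/setP => v; rewrite inE mem_imset.
(* The test holds exactly for [t] inside the image of [sigma]. *)
pose c : chain' := [ffun t : {set V'} => if t == sigma @: (pre t)
  then reorder_sgn (pre t) *: b (pre t) else 0].
exists c; last first.
  apply/ffunP => s; rewrite !ffunE preK ifT ?eqxx // scalerA reorder_sgn_sqr.
  exact: scale1r.
apply/chainsP => t; rewrite ffunE; case: ifP => [/eqP E|_]; last by rewrite eqxx.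
move=> bs; have [|sK sq] := bK (pre t).
  by apply: contraNneq bs => ->; rewrite scaler0.
move: sK; rewrite E preK !inE facesK => /andP[-> sJ]; split; last by rewrite card_imset.
by rewrite imset_subE.
Qed.

(** Leaving [A] free, instead of fixing [sigma @: J], lets naturality in [A] and in [J] be stated
    without casts between equal vertex sets. *)
Definition rpull A J (h : A \subset sigma @: J) p :
    {linear rhom k (full K' A) p -> rhom k (full K J) p} :=
  subquot_map (pullc_cycles (p := p) h) (pullc_bounds (p := p) h).

Lemma rpullE A J (h : A \subset sigma @: J) p c :
  rpull h p (subquot_class (bounds (full K' A) p) c) =
  subquot_class (bounds (full K J) p) (submod_map (pullc_cycles (p := p) h) c).
Proof. exact: subquot_mapE. Qed.

Lemma rpull_inj J p : injective (rpull (subxx (sigma @: J)) p).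
Proof.
apply: subquot_map_injective => c /andP[cK _] /asboolP[b bK cb]; apply/asboolP.
have [b' bK' bE] := pullc_surj bK; exists b' => //.
apply/eqP; rewrite -subr_eq0; apply/eqP/(@pullc_inj _ J) => [t tJ|].
  rewrite !ffunE (chains_carried (subxx _) cK) // sub0r.
  have := carried_bd (chains_carried (subxx _) bK') tJ.
  by rewrite ffunE => ->; rewrite oppr0.
rewrite linearB /= -(bd_pullc (chains_carried (subxx _) bK')) bE cb.
exact: subrr.
Qed.

Lemma rpull_surj J p y : exists x, rpull (subxx (sigma @: J)) p x = y.
Proof.
apply: subquot_map_surjective => b /andP[bK /eqP b0].
have [c cK cb] := pullc_surj bK; exists c; last by rewrite -cb subrr rpred0.
have cJ := chains_carried (subxx _) cK.
apply/andP; split=> //; apply/eqP; apply: (pullc_inj (carried_bd cJ)).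
by rewrite -(bd_pullc cJ) cb.
Qed.

Lemma rpull_restrict A B J (IJ : A \subset B) (hI : A \subset sigma @: J)
    (hJ : B \subset sigma @: J) p x :
  rpull hJ p (rhom_map k (fullS (subxx (faces K')) IJ) p x) = rpull hI p x.
Proof.
have [c ->] := subquot_class_surj x.
rewrite (rhom_mapE (fullS (subxx (faces K')) IJ)) !rpullE.
by congr subquot_class; apply: val_inj.
Qed.

Lemma rpull_extend A I J (IJ : I \subset J) (hI : A \subset sigma @: I)
    (hJ : A \subset sigma @: J) p x :
  rhom_map k (fullS (subxx (faces K)) IJ) p (rpull hI p x) = rpull hJ p x.
Proof.
have [c ->] := subquot_class_surj x.
rewrite !rpullE (rhom_mapE (fullS (subxx (faces K)) IJ)).
by congr subquot_class; apply: val_inj.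
Qed.

Lemma rpull_transport p (x : mahom k K' p) A B J (hA : A \subset sigma @: J)
    (hB : B \subset sigma @: J) :
  A = B -> rpull hA p (dsum_proj A x) = rpull hB p (dsum_proj B x).
Proof. by move=> AB; subst B; rewrite (bool_irrelevance hA hB). Qed.

(** The quotient map of double complexes that drops the sets outside the image of [sigma];
    [reorder_sgn] absorbs the change of order in the signs of [ddiff]. *)
Definition mpull p (x : mahom k K' p) : mahom k K p :=
  dsum_mk (fun J => reorder_sgn J *: rpull (subxx (sigma @: J)) p (dsum_proj (sigma @: J) x)).

Lemma mpull_linear p : linear (@mpull p).
Proof.
move=> a x y; apply/dsumP => J; by rewrite linearP /= !dsum_mkE !linearP.
Qed.
HB.instance Definition _ p := GRing.isLinear.Build k (mahom k K' p)
  (mahom k K p) _ (@mpull p) (@mpull_linear p).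

Lemma mpull_ddiff p x : mpull (ddiff x) = ddiff (mpull x) :> mahom k K p.
Proof.
apply/dsumP => J; rewrite dsum_mkE !ddiffE linearZ /= scalerA mulrC -scalerA.
congr (_ *: _); rewrite linear_sum scaler_sumr /= big_imset /=; last first.
  by move=> u v _ _; apply: sigma_inj.
apply: eq_bigr => v vJ.
have E : (sigma @: J) :\ sigma v = sigma @: (J :\ v).
  by rewrite -{1}(setD1K vJ) imsetU1 setU1K // mem_imset // !inE eqxx.
have h : (sigma @: J) :\ sigma v \subset sigma @: J by exact: subD1set.
have h' : (sigma @: J) :\ sigma v \subset sigma @: (J :\ v) by rewrite E.
rewrite dsum_mkE; set y := dsum_proj (sigma @: (J :\ v)) x.
have -> : phi k K p J v (reorder_sgn (J :\ v) *: rpull (subxx (sigma @: (J :\ v))) p y) =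
    reorder_sgn (J :\ v) *: rpull (imsetS sigma (subD1set J v)) p y.
  apply: etrans (linearZ _ _) _; congr (_ *: _).
  exact: (rpull_extend (subD1set J v)).
have -> : rpull (subxx (sigma @: J)) p (sgn k (sigma v) ((sigma @: J) :\ sigma v) *:
      phi k K' p (sigma @: J) (sigma v) (dsum_proj ((sigma @: J) :\ sigma v) x)) =
    sgn k (sigma v) ((sigma @: J) :\ sigma v) *: rpull (imsetS sigma (subD1set J v)) p y.
  apply: etrans (linearZ _ _) _; congr (_ *: _).
  apply: etrans (rpull_restrict (subD1set _ _) h (subxx _) _) _.
  exact: rpull_transport.
have vJv : v \notin J :\ v by rewrite setD11.
rewrite E !scalerA; congr (_ *: _).
have := reorder_sgnU vJv; rewrite setD1K // => key.
apply: (mulfI (sgn_neq0 k v (J :\ v))).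
by rewrite !mulrA key sgn_sqr mul1r mulrAC sgn_sqr mul1r.
Qed.

Lemma mpull_part p j x : x \in mahom_part j -> mpull x \in mahom_part (p := p) j.
Proof.
move=> /mahom_partP xj; apply/mahom_partP => J; rewrite dsum_mkE => xJ.
rewrite -(card_imset J sigma_inj); apply: xj.
by apply: contraNneq xJ => ->; rewrite linear0 scaler0.
Qed.

Lemma mpull_dcycles p j :
  {homo @mpull p : x / x \in dcycles j >-> x \in dcycles (p := p) j}.
Proof.
move=> x /andP[xj /eqP x0]; apply/andP; split; first exact: mpull_part.
by rewrite -mpull_ddiff x0 linear0.
Qed.

Lemma mpull_dbounds p j :
  {homo @mpull p : x / x \in dbounds j >-> x \in dbounds (p := p) j}.
Proof.
move=> _ /asboolP[y yj ->]; apply/asboolP; exists (mpull y); first exact: mpull_part.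
by rewrite mpull_ddiff.
Qed.

Definition HH_pull i j : {linear HH k K' i j -> HH k K i j} :=
  subquot_map (@mpull_dcycles (j - i - 1) j) (@mpull_dbounds (j - i - 1) j).

Lemma HH_pullE i j x :
  HH_pull i j (subquot_class (dbounds j) x) =
  subquot_class (dbounds j) (submod_map (@mpull_dcycles (j - i - 1) j) x).
Proof. exact: subquot_mapE. Qed.

Lemma mpull_surj p j x : x \in mahom_part j ->
  exists2 y, y \in mahom_part (p := p) j & mpull y = x.
Proof.
move=> xj.
(* The first clause confines the preimage to images of sets in the support of [x], whence its degree
   [j]. *)
pose spec A (m : rhom k (full K' A) p) := (m != 0 -> exists2 J : {set V}, A = sigma @: J &
  dsum_proj J x != 0) /\ forall (J : {set V}) (h : A \subset sigma @: J), A = sigma @: J ->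
  reorder_sgn J *: rpull h p m = dsum_proj J x.
have /dependent_choice[y yP] : forall A, exists m, spec A m.
  move=> A; rewrite /spec; have [[J ->]|nA] := pselect (exists J : {set V}, A = sigma @: J).
    have [y yE] := rpull_surj (reorder_sgn J *: dsum_proj J x).
    exists y; split=> [y0|I h /(imset_inj sigma_inj) JI].
      exists J => //; apply: contraNneq y0 => xJ0; apply/eqP/rpull_inj.
      by rewrite yE xJ0 scaler0 linear0.
    subst I; rewrite (bool_irrelevance h (subxx _)) yE scalerA reorder_sgn_sqr.
    exact: scale1r.
  exists 0; split=> [|J h AJ]; first by rewrite eqxx.
  by case: nA; exists J.
exists (dsum_mk y).
  apply/mahom_partP => A; rewrite dsum_mkE => /(proj1 (yP A))[J -> xJ].
  by rewrite card_imset // (mahom_partP _ _ xj).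
by apply/dsumP => J; rewrite !dsum_mkE (proj2 (yP _)).
Qed.

Lemma mpull_eq0 p (x : mahom k K' p) :
  mpull x = 0 -> vanishes_on (sigma @: setT) x.
Proof.
move=> x0 A AT; rewrite -(imset_preimset AT); set J := sigma @^-1: A.
have : dsum_proj J (mpull x) = 0 by rewrite x0 linear0.
rewrite dsum_mkE => /(scaler_eq0_unit (reorder_sgn_neq0 _)) E.
by apply: (@rpull_inj J); rewrite linear0.
Qed.

Lemma vanishes_on_mpull p (x : mahom k K' p) :
  vanishes_on (sigma @: setT) x -> mpull x = 0.
Proof.
move=> x0; apply/dsumP => J; rewrite dsum_mkE x0 ?linear0 ?scaler0 //.
by rewrite imset_subE subsetT.
Qed.

Section Retract.
Variable r : V' -> V.
Hypothesis dom : forall u : V', dominated K' (sigma (r u)) u.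

Let rT u : sigma (r u) \in sigma @: setT. Proof. exact: imset_f. Qed.

(** If [mpull x] bounds [b], lift [b] to [b']: then [x - ddiff b'] is a cycle in the kernel of
    [mpull], which is acyclic. *)
Lemma HH_pull_inj i j : injective (HH_pull i j).
Proof.
apply: subquot_map_injective => x /andP[xj /eqP x0] /asboolP[b bj xb]; apply/asboolP.
have [b' bj' bE] := mpull_surj bj.
have xbj : x - ddiff b' \in mahom_part j.
  by apply: mahom_partB => //; apply: ddiff_part.
have [||y [yj yW yE]] := vanishes_on_acyclic rT dom xbj.
- by rewrite [LHS](linearB (@ddiff k _ _ K' _)) /= x0 ddiff_ddiff subrr.
- apply: mpull_eq0; rewrite linearB /= mpull_ddiff bE xb.
  exact: subrr.
exists (b' + y); first exact: mahom_partD.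
by rewrite [RHS](linearD (@ddiff k _ _ K' _)) /= yE [RHS]addrC subrK.
Qed.

(** For a lift [x'] of a cycle, [ddiff x'] is a cycle in the acyclic kernel, so [x'] can be
    corrected by an element of the kernel to a cycle. *)
Lemma HH_pull_surj i j y : exists x, HH_pull i j x = y.
Proof.
apply: subquot_map_surjective => x /andP[xj /eqP x0].
have [x' xj' xE] := mpull_surj xj.
have dj : ddiff x' \in mahom_part (j + 1) by apply: ddiff_part; rewrite addrK.
have [||y' [yj yW yE]] := vanishes_on_acyclic rT dom dj.
- exact: ddiff_ddiff.
- by apply: mpull_eq0; rewrite mpull_ddiff xE.
rewrite addrK in yj; exists (x' - y').
  apply/andP; split; first exact: mahom_partB.
  by rewrite [ddiff _](linearB (@ddiff k _ _ K' _)) /= yE subrr.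
rewrite linearB /= (vanishes_on_mpull yW) subr0 xE subrr.
by apply/asboolP; exists 0; [have [] := mahom_part_closed k K (j - i - 1) (j - 1)
  | rewrite (linear0 (@ddiff k _ _ K _))].
Qed.
End Retract.
End Faces.

Lemma HH_pull_natural (K L : scomplex V) (K' L' : scomplex V') facesK facesL
    (KL : K \subset L) (KL' : K' \subset L') i j x :
  @HH_pull L L' facesL i j (HH_map k KL' i j x) =
  HH_map k KL i j (@HH_pull K K' facesK i j x).
Proof.
have [y ->] := subquot_class_surj x.
apply: etrans (congr1 _ (HH_mapE _ _)) _.
apply: etrans (HH_pullE _ _) (esym _).
apply: etrans (congr1 _ (HH_pullE _ _)) _.
apply: etrans (HH_mapE _ _) _.
congr subquot_class; apply/val_inj/dsumP => J.
rewrite /= !dsum_mkE linearZ /=; congr (_ *: _).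
have [c ->] := subquot_class_surj (dsum_proj (sigma @: J) (submod_val y)).
rewrite /rpull !subquot_mapE.
by congr subquot_class; apply: val_inj.
Qed.
End Pullback.

(** * Marriage theorem and unitriangular matrices *)

Section Hall.
Variables A B : finType.
Implicit Types (N : A -> {set B}) (S T : {set A}).
Local Open Scope nat_scope.

(* Rado's argument: some point can be removed from any [N a] with two points
   without breaking the marriage condition. *)
Lemma hall_marriage N :
  (forall S, #|S| <= #|\bigcup_(a in S) N a|) ->
  exists2 f : A -> B, injective f & forall a, f a \in N a.
Proof.
have [n] := ubnP (\sum_a #|N a|); elim: n => // n IH in N *; rewrite ltnS => Nn hall.
have [/forallP N1|/forallPn[a]] := boolP [forall a, #|N a| <= 1].
  have N1' a : exists b, N a == [set b].
    have /cards1P[b ->] : #|N a| == 1; last by exists b.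
    by rewrite eqn_leq N1; have := hall [set a]; rewrite cards1 big_set1.
  exists (fun a => xchoose (N1' a)) => [a a' E|a]; last first.
    by rewrite {2}(eqP (xchooseP (N1' a))) set11.
  apply/eqP; apply: contraT => aa'; have := hall [set a; a'].
  rewrite cards2 aa' big_setU1 ?inE //= big_set1.
  rewrite (eqP (xchooseP (N1' a))) (eqP (xchooseP (N1' a'))) E setUid.
  by rewrite cards1.
rewrite -ltnNge => /card_gt1P[b1 [b2 [b1N b2N b12]]].
pose N' b x := if x == a then N a :\ b else N x.
have N'N b x : N' b x \subset N x.
  by rewrite /N'; case: eqP => [->|_] //; exact: subD1set.
have shrink b : b \in N a ->
    (forall S, #|S| <= #|\bigcup_(x in S) N' b x|) ->
    exists2 f : A -> B, injective f & forall x, f x \in N x.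
  move=> bN hall'; have [|f fI fN] := IH (N' b) _ hall'; last first.
    by exists f => // x; apply: subsetP (N'N b x) _ (fN x).
  apply: leq_trans Nn; rewrite (bigD1 a) //= [leqRHS](bigD1 a) //=.
  rewrite {1}/N' eqxx (cardsD1 b (N a)) bN add1n !addSn ltnS leq_add2l.
  by apply: leq_sum => x _; apply: subset_leq_card.
have [/forallP h1|/forallPn[T1]] :=
  boolP [forall S : {set A}, #|S| <= #|\bigcup_(x in S) N' b1 x|]; first exact: shrink h1.
have [/forallP h2 _|/forallPn[T2]] :=
  boolP [forall S : {set A}, #|S| <= #|\bigcup_(x in S) N' b2 x|]; first exact: shrink h2.
rewrite -!ltnNge => t2 t1.
(* If neither point can be removed, violating sets [T1] and [T2] both contain [a]. Their union still
   sees all of [N a] because [b1 != b2], and their intersection gives up only [a]; counting both,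
   two deficits meet a slack of one. *)
have aT b T : #|\bigcup_(x in T) N' b x| < #|T| -> a \in T.
  rewrite ltnNge; apply: contraR => aT.
  rewrite (eq_bigr N) => [|x xT]; first exact: hall.
  by rewrite /N'; case: eqP => // xa; rewrite -xa xT in aT.
have aT1 := aT _ _ t1; have aT2 := aT _ _ t2.
have hU : #|T1 :|: T2| <=
    #|(\bigcup_(x in T1) N' b1 x) :|: (\bigcup_(x in T2) N' b2 x)|.
  apply: leq_trans (hall _) (subset_leq_card _); apply/bigcupsP => x.
  have [-> _|xa] := eqVneq x a.
    apply/subsetP => b bN; rewrite in_setU; have [bb1|bb1] := eqVneq b b1.
      apply/orP; right; apply/bigcupP; exists a => //.
      by rewrite /N' eqxx !inE bN bb1 b12.
    apply/orP; left; apply/bigcupP; exists a => //.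
    by rewrite /N' eqxx !inE bN bb1.
  rewrite in_setU => xT; apply/subsetP => b bN; rewrite in_setU.
  by apply/orP; case/orP: xT => xT; [left|right]; apply/bigcupP; exists x => //;
    rewrite /N' (negPf xa).
have hI : #|(T1 :&: T2) :\ a| <=
    #|(\bigcup_(x in T1) N' b1 x) :&: (\bigcup_(x in T2) N' b2 x)|.
  apply: leq_trans (hall _) (subset_leq_card _); apply/bigcupsP => x.
  rewrite !inE => /and3P[xa xT1 xT2]; apply/subsetP => b bN; rewrite in_setI.
  by apply/andP; split; apply/bigcupP; exists x => //; rewrite /N' (negPf xa).
have := cardsD1 a (T1 :&: T2); rewrite in_setI aT1 aT2 add1n => cI.
have := leq_add t1 t2; rewrite -(cardsUI T1) cI addSn !addnS ltnS => t12.
by have := leq_trans t12 (leq_add hU hI); rewrite cardsUI ltnn.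
Qed.
End Hall.

(** The product matrix over [S] is invertible: a nonzero row vector in its kernel is tested at the
    index of its support with largest [alpha], where only the diagonal entry contributes. Its rank
    [#|S|] is at most the inner dimension [#|T|]. *)
Lemma unitriangular_card (F : fieldType) (disp : Order.disp_t) (O : orderType disp)
    (A B : finType) (S : {set A}) (T : {set B}) (f : A -> B -> F) (g : B -> A -> F)
    (alpha : A -> O) :
  (forall a a', a \in S -> a' \in S -> (alpha a <= alpha a')%O ->
     \sum_(b in T) f a b * g b a' = (a == a')%:R) ->
  (#|S| <= #|T|)%N.
Proof.
move=> fg.
pose P := \matrix_(i < #|S|, j < #|T|) f (enum_val i) (enum_val j).
pose Q := \matrix_(j < #|T|, i < #|S|) g (enum_val j) (enum_val i).
have PQ i i' : (alpha (enum_val i) <= alpha (enum_val i'))%O ->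
    (P *m Q) i i' = (i == i')%:R.
  move=> ii'; rewrite -(inj_eq enum_val_inj) -fg ?enum_valP // mxE.
  rewrite [RHS]big_enum_val.
  by apply: eq_bigr => j _; rewrite !mxE.
suff : row_free (P *m Q).
  rewrite /row_free => /eqP <-; exact: mulmx_max_rank.
apply: inj_row_free => u u0; apply/eqP; apply: contraT => /rV0Pn[i0 ui0].
pose i := [arg max_(i > i0 | u 0 i != 0) alpha (enum_val i)]%O.
have [ui imax] : u 0 i != 0 /\
    forall j, u 0 j != 0 -> (alpha (enum_val j) <= alpha (enum_val i))%O.
  by rewrite /i; case: arg_maxP => // i1 ? ?; split.
have := congr1 (fun v : 'rV_#|S| => v 0 i) u0; rewrite !mxE (bigD1 i) //= big1 => [|j ji].
  by rewrite addr0 PQ // eqxx mulr1 => /eqP E; rewrite E in ui.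
have [->|uj] := eqVneq (u 0 j) 0; first by rewrite mul0r.
by rewrite PQ ?imax // (negPf ji) mulr0.
Qed.

From mathcomp Require Import classical_sets reals constructive_ereal ereal.
From mathcomp Require Import interval_inference.

(** * Interleavings *)

Local Notation pmap := Defs.pmap.

Lemma linear_fun (k : fieldType) (U W : lmodType k) (f : U -> W) :
  linear f -> exists g : {linear U -> W}, g =1 f.
Proof.
move=> fL; pose m := GRing.isLinear.Build k U W _ f fL.
by exists (HB.pack f m : {linear U -> W}).
Qed.

Lemma inj_surj_bij (A B : Type) (f : A -> B) :
  injective f -> (forall y, exists x, f x = y) -> bijective f.
Proof.
move=> fI /dependent_choice[g gK]; exists g => // x.
by apply: fI; rewrite gK.
Qed.

Section Interleaving.
Variables (k : fieldType) (R : realType).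
Implicit Types (M N : pmod k R) (e : R) (r s t u : {nonneg R}).

(** Indexing by all pairs [s + e <= t], not only [t = s + e], avoids transport along equalities of
    parameters. *)
Definition shifted_maps e M N :=
  forall s t, s%:num + e <= t%:num -> {linear M s -> N t}.

Definition shift_natural e M N (f : shifted_maps e M N) :=
  forall r s t u (rs : r <= s) (tu : t <= u) (st : s%:num + e <= t%:num)
    (ru : r%:num + e <= u%:num) x,
  pmap N tu (f s t st (pmap M rs x)) = f r u ru x.

Definition shift_inverse e M N (f : shifted_maps e M N) (g : shifted_maps e N M) :=
  forall s t u (st : s%:num + e <= t%:num) (tu : t%:num + e <= u%:num)
    (su : s <= u) x, g t u tu (f s t st x) = pmap M su x.

Definition interleaved e M N := exists f g,
  [/\ @shift_natural e M N f, @shift_natural e N M g,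
      shift_inverse f g & shift_inverse g f].

Lemma interleaved_sym e M N : interleaved e M N -> interleaved e N M.
Proof. by move=> [f [g [? ? ? ?]]]; exists g, f. Qed.

Lemma interleaved_isol e M M' N : pmod_iso M M' -> interleaved e M N -> interleaved e M' N.
Proof.
move=> [a [abij an]] [f [g [fn gn fg gf]]].
have /dependent_choice[b bP] : forall t, exists b : {linear M' t -> M t},
    cancel (a t) b /\ cancel b (a t).
  move=> t; have [b aK bK] := abij t.
  have [b' b'E] := linear_fun (can2_linear aK bK).
  by exists b'; split=> x; rewrite b'E.
have aK t : cancel (a t) (b t) by case: (bP t).
have bK t : cancel (b t) (a t) by case: (bP t).
have bn s t (st : s <= t) x : b t (pmap M' st x) = pmap M st (b s x).
  by rewrite -{1}(bK s x) -an aK.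
exists (fun s t st => f s t st \o b s), (fun s t st => a t \o g s t st); split.
- by move=> r s t u rs tu st ru x /=; rewrite bn (fn _ _ _ _ _ _ _ ru).
- by move=> r s t u rs tu st ru x /=; rewrite -an (gn _ _ _ _ _ _ _ ru).
- by move=> s t u st tu su x /=; rewrite (fg _ _ _ _ _ su) an bK.
- by move=> s t u st tu su x /=; rewrite aK (gf _ _ _ _ _ su).
Qed.

Lemma interleaved_iso e M M' N N' : pmod_iso M M' -> pmod_iso N N' ->
  interleaved e M N -> interleaved e M' N'.
Proof.
move=> iM iN /(interleaved_isol iM)/interleaved_sym/(interleaved_isol iN).
exact: interleaved_sym.
Qed.

Lemma interleaved_psum e (I : finType) (M N : I -> pmod k R) :
  (forall i, interleaved e (M i) (N i)) -> interleaved e (psum M) (psum N).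
Proof.
move=> /dependent_choice[f /dependent_choice[g fg]].
exists (fun s t st => dsum_map (fun i => f i s t st)).
exists (fun s t st => dsum_map (fun i => g i s t st)).
split=> [r s t u rs tu st ru x|r s t u rs tu st ru x|s t u st tu su x|s t u st tu su x];
  apply/dsumP => i; rewrite !dsum_mkE; case: (fg i) => fn gn fgi gfi.
- exact: fn.
- exact: gn.
- exact: fgi.
- exact: gfi.
Qed.

Lemma pmod_iso_psum_support (I J : finType) (h : I -> J) (M : J -> pmod k R) :
    injective h -> (forall j t (x : M j t), j \notin codom h -> x = 0) ->
  pmod_iso (psum M) (psum (fun i => M (h i))).
Proof.
move=> hI M0.
pose f t (x : psum M t) : psum (fun i => M (h i)) t :=
  dsum_mk (fun i => dsum_proj (h i) x).
have /dependent_choice[F FE] t : exists F : {linear _ -> _}, F =1 f t.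
  apply: linear_fun => a x y; apply/dsumP => i.
  by rewrite linearP /= !dsum_mkE.
exists F; split=> [t|s t st x]; last first.
  by rewrite !FE; apply/dsumP => i; rewrite !dsum_mkE.
apply: inj_surj_bij => [x y|y].
  rewrite !FE => /dsumP xy; apply/dsumP => j.
  have [/codomP[i ->]|jh] := boolP (j \in codom h).
    by have := xy i; rewrite !dsum_mkE.
  by rewrite (M0 _ _ (dsum_proj j x)) // (M0 _ _ (dsum_proj j y)).
(* The component at [j] is that of [y] at the unique preimage of [j], transported along [E], and 0
   outside the image. *)
have /dependent_choice[x xP] j : exists z : M j t, forall i (E : h i = j),
    eq_rect _ (fun j => M j t : Type) (dsum_proj i y) _ E = z.
  have [/codomP[i ->]|jh] := boolP (j \in codom h).
    exists (dsum_proj i y) => i' E; have ii' := hI _ _ E; subst i'.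
    by rewrite (eq_irrelevance E erefl).
  by exists 0 => i E; case/negP: jh; rewrite -E codom_f.
exists (dsum_mk x); rewrite FE; apply/dsumP => i; rewrite !dsum_mkE.
by rewrite -(xP _ i erefl).
Qed.
End Interleaving.

(** * Double homology of Vietoris-Rips filtrations *)

Section RipsModules.
Variables (k : fieldType) (R : realType).

Definition pull_metric (Z X : Type) (pi : Z -> X) (d : pseudo_metric R X) :
    pseudo_metric R Z :=
  @Defs.PseudoMetric R Z (fun x y => d (pi x) (pi y)) (fun x y => pdist_ge0 d _ _)
    (fun x => pdist_xx d _) (fun x y => pdist_sym d _ _)
    (fun x y z => pdist_triangle d _ _ _).

(** A point [u] is at distance 0 from [sigma (pi u)], so it can be added to every simplex containing
    that representative. This is the domination required by [HH_pull]. *)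
Lemma PHHZij_pull (dispZ dispX : Order.disp_t) (Z : finOrderType dispZ)
    (X : finOrderType dispX) (pi : Z -> X) (sigma : X -> Z)
    (d : pseudo_metric R X) i j :
  cancel sigma pi ->
  pmod_iso (PHHZij k (pull_metric pi d) i j) (PHHZij k d i j).
Proof.
move=> sK; have sI := can_inj sK; set d' := pull_metric pi d.
have faces_eq t (s : {set X}) : (sigma @: s \in VR d' t) = (s \in VR d t).
  apply/vr_facesP/vr_facesP => st x y.
    move=> xs ys xy; have := st _ _ (imset_f sigma xs) (imset_f sigma ys).
    by rewrite /= !sK; apply; rewrite inj_eq.
  move=> /imsetP[x' xs ->] /imsetP[y' ys ->]; rewrite inj_eq // /= !sK.
  exact: st.
exists (fun t => HH_pull k sI (faces_eq t%:num) i j); split=> [t|s t st x].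
  have dom u : dominated (VR d' t%:num) (sigma (pi u)) u.
    move=> s /vr_facesP st us; apply/vr_facesP => x y.
    have du z : d (pi u) (pi z) = d' (sigma (pi u)) z by rewrite /= sK.
    have near z : z \in s -> d' u z <= t%:num.
      move=> zs; rewrite /= du; have [->|zu] := eqVneq (sigma (pi u)) z.
        by rewrite pdist_xx.
      exact: st.
    rewrite !in_setU1 => /predU1P[->|xs] /predU1P[->|ys].
    - by rewrite eqxx.
    - by move=> _; apply: near.
    - by move=> _; rewrite pdist_sym; apply: near.
    - exact: st.
  apply: inj_surj_bij; first exact: (HH_pull_inj dom).
  exact: (HH_pull_surj sI (faces_eq t%:num) dom).
exact: HH_pull_natural.
Qed.

(** Below degree -1 there are no chains; in degree -1 the empty simplex is the boundary of any
    vertex. *)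
Lemma rhom_neg (disp : Order.disp_t) (V : finOrderType disp) (K : scomplex V)
    (p : int) (q : rhom k K p) :
  p < 0 -> (p = -1 -> exists z, [set z]%SET \in faces K) -> q = 0.
Proof.
move=> p0 Kz; have [[c cK] ->] := subquot_class_surj q.
rewrite -(linear0 (subquot_class (bounds K p))); apply/subquot_classP.
rewrite raddf0 addr0 /=; have /andP[/chainsP cP /eqP c0] := cK.
apply/asboolP; have [p1|p1] := eqVneq p (-1); last first.
  exists 0; first by have [] := chains_closed k K (p + 1).
  rewrite linear0; apply/ffunP => s; rewrite [RHS]ffunE; apply/eqP.
  apply: contraT => /cP[_ sp]; move: p1; rewrite -(addrK 1 p) -sp.
  by move: p0; rewrite -(addrK 1 p) -sp; case: #|s|.
have [z zK] := Kz p1; exists (cone z c); last first.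
  rewrite bd_cone c0; suff -> : cone z 0 = 0 :> {ffun {set V} -> k^o} by rewrite subr0.
  by apply/ffunP => s; rewrite !ffunE scaler0; case: ifP.
apply/chainsP => s; rewrite ffunE; case: ifP => [zs|]; last by rewrite eqxx.
move=> cs; have [|_] := cP (s :\ z).
  by apply: contraNneq cs => ->; rewrite scaler0.
rewrite p1 => /eqP; rewrite addNr -[0]/(Posz 0) eqz_nat cards_eq0 => /eqP sz.
by rewrite -(finset.setD1K zs) sz finset.setU0 cards1.
Qed.

(** Components live on sets [J] with [j] elements, so [j <= #|X|]. If also [#|X| <= i], the degree
    [j - i - 1] is negative, and it equals -1 only when [j = i > 0], where [J] has a vertex. *)
Lemma PHHZij_eq0 (disp : Order.disp_t) (X : finOrderType disp)
    (d : pseudo_metric R X) (i j : nat) (t : {nonneg R}) (x : PHHZij k d i j t) :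
  (0 < #|X|)%N -> (#|X| <= i)%N || (#|X| < j)%N -> x = 0.
Proof.
move=> X0 ij; have [[y yP] ->] := subquot_class_surj x.
rewrite -(linear0 (subquot_class
  (dbounds (k := k) (K := VR d t%:num) (p := j%:Z - i%:Z - 1) j%:Z))).
congr subquot_class; apply/val_inj/dsumP => J /=; rewrite linear0.
have /andP[/mahom_partP yj _] := yP.
have [//|yJ] := eqVneq (dsum_proj J y) 0.
have /eqP := yj _ yJ; rewrite eqz_nat => /eqP Jj.
have JX : (j <= #|X|)%N by rewrite -Jj; apply: max_card.
have iX : (#|X| <= i)%N by case/orP: ij => //; rewrite ltnNge JX.
apply: rhom_neg => [|p1].
  by rewrite subr_lt0 -[ltRHS]add0r ltzD1 subr_le0 lez_nat (leq_trans JX).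
have : (0 < #|J|)%N.
  rewrite Jj; apply: leq_trans X0 (leq_trans iX _).
  by move/eqP: p1; rewrite subr_eq addNr subr_eq0 => /eqP[->].
case/card_gt0P => z zJ; exists z; rewrite inE finset.sub1set zJ andbT.
by apply/vr_facesP => u v; rewrite !inE => /eqP-> /eqP->; rewrite eqxx.
Qed.

(** A common range of bidegrees allows spaces of different cardinality to be compared summand by
    summand. *)
Lemma PHHZ_enlarge (disp : Order.disp_t) (X : finOrderType disp)
    (d : pseudo_metric R X) n : (0 < #|X| <= n)%N ->
  pmod_iso (psum (fun ij : 'I_n * 'I_n.+1 => PHHZij k d ij.1%:Z ij.2%:Z))
           (PHHZ k d).
Proof.
move=> /andP[X0 Xn]; have Xn1 : (#|X|.+1 <= n.+1)%N by [].
pose h (ij : 'I_#|X| * 'I_#|X|.+1) := (widen_ord Xn ij.1, widen_ord Xn1 ij.2).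
apply: (pmod_iso_psum_support (h := h)).
  move=> [i j] [i' j'] E; congr pair; apply: ord_inj.
    exact: (congr1 (fun u => val u.1) E).
  exact: (congr1 (fun u => val u.2) E).
move=> [i j] t x /negP ijh; apply: PHHZij_eq0 => //.
apply: contraT; rewrite negb_or -ltnNge -leqNgt => /andP[iX jX]; case: ijh.
apply/codomP; exists (Ordinal iX, Ordinal (jX : (j < #|X|.+1)%N)).
by congr pair; apply: ord_inj.
Qed.

Lemma PHHZij_interleaved (disp : Order.disp_t) (Z : finOrderType disp)
    (d d' : pseudo_metric R Z) (e : R) i j :
  (forall x y, `|d x y - d' x y| <= e) ->
  interleaved e (PHHZij k d i j) (PHHZij k d' i j).
Proof.
move=> dd'.
have sub (a b : pseudo_metric R Z) : (forall x y, b x y <= a x y + e) ->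
    forall s t, s + e <= t -> VR a s \subset VR b t.
  move=> ab s t st; apply/fintype.subsetP => r /vr_facesP rs.
  apply/vr_facesP => x y xr yr xy; apply: le_trans (ab _ _) (le_trans _ st).
  by rewrite lerD2r; apply: rs.
have ab x y : d' x y <= d x y + e.
  by have := dd' x y; rewrite ler_norml => /andP[]; lra.
have ba x y : d x y <= d' x y + e.
  by have := dd' x y; rewrite ler_norml => /andP[]; lra.
exists (fun s t st => HH_map k (sub _ _ ab _ _ st) i j).
exists (fun s t st => HH_map k (sub _ _ ba _ _ st) i j).
split=> [r s t u rs tu st ru x|r s t u rs tu st ru x|s t u st tu su x|s t u st tu su x].
- have h : VR d r%:num \subset VR d' t%:num by apply: sub => //; apply: le_trans st; rewrite lerD2r.
  exact: etrans (congr1 _ (HH_map_comp _ _ h _)) (HH_map_comp _ _ _ _).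
- have h : VR d' r%:num \subset VR d t%:num by apply: sub => //; apply: le_trans st; rewrite lerD2r.
  exact: etrans (congr1 _ (HH_map_comp _ _ h _)) (HH_map_comp _ _ _ _).
- exact: HH_map_comp.
- exact: HH_map_comp.
Qed.

Lemma PHHZ_interleaved (dispX dispY : Order.disp_t) (X : finOrderType dispX)
    (Y : finOrderType dispY) (dX : pseudo_metric R X) (dY : pseudo_metric R Y)
    (C : {set X * Y}) (e : R) :
    (0 < #|X|)%N -> (0 < #|Y|)%N ->
    (forall x, exists y, (x, y) \in C) -> (forall y, exists x, (x, y) \in C) ->
    (forall a b, a \in C -> b \in C -> `|dX a.1 b.1 - dY a.2 b.2| <= e) ->
  interleaved e (PHHZ k dX) (PHHZ k dY).
Proof.
move=> X0 Y0 /dependent_choice[f fC] /dependent_choice[g gC] Ce.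
(* The common vertex set is [C], enumerated by ['I_n] to obtain a total order; [f] and [g] provide
   sections of its two projections. *)
set n := #|C|; pose piX (z : 'I_n) := (enum_val z).1; pose piY (z : 'I_n) := (enum_val z).2.
pose sX x : 'I_n := enum_rank_in (fC x) (x, f x).
pose sY y : 'I_n := enum_rank_in (gC y) (g y, y).
have sXK : cancel sX piX by move=> x; rewrite /piX enum_rankK_in.
have sYK : cancel sY piY by move=> y; rewrite /piY enum_rankK_in.
have Xn : (#|X| <= n)%N by rewrite -[n]card_ord; apply: leq_card (can_inj sXK).
have Yn : (#|Y| <= n)%N by rewrite -[n]card_ord; apply: leq_card (can_inj sYK).
have iX : pmod_iso _ (PHHZ k dX) := PHHZ_enlarge dX (introT andP (conj X0 Xn)).
have iY : pmod_iso _ (PHHZ k dY) := PHHZ_enlarge dY (introT andP (conj Y0 Yn)).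
apply: (interleaved_iso iX iY); apply: interleaved_psum => -[i j].
apply: interleaved_iso (PHHZij_pull _ _ _ sXK) (PHHZij_pull _ _ _ sYK) _.
apply: PHHZij_interleaved => x y; apply: Ce; exact: enum_valP.
Qed.
End RipsModules.

(** * Stability of barcodes *)

Section IntervalSum.
Variables (k : fieldType) (R : realType) (n : nat) (I : 'I_n -> bar R).
Local Notation M := (psum (fun i => ival k (I i))).
Implicit Types (s t : {nonneg R}).

(** The row has width 1 inside the bar and 0 outside; [pid_mx 1] is 1 or empty accordingly, without
    a case distinction on the type. In [coef] the same factor turns a row of either width into a
    scalar. *)
Definition gen i t : M t := dsum_mk (fun i' =>
  ((i' == i)%:R *: pid_mx 1 : 'rV[k]_(in_bar (I i') t)) : ival k (I i') t).

Definition coef i t (x : M t) : k :=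
  ((dsum_proj i x : 'rV[k]_(in_bar (I i) t)) *m (pid_mx 1 : 'cV_(in_bar (I i) t))) 0 0.

Lemma coefD i t (x y : M t) : coef i (x + y) = coef i x + coef i y.
Proof. by rewrite /coef linearD /= mulmxDl mxE. Qed.

Lemma coefZ i t a (x : M t) : coef i (a *: x) = a * coef i x.
Proof. by rewrite /coef linearZ /= -scalemxAl mxE. Qed.

Lemma coef0 i t : coef i (0 : M t) = 0.
Proof. by rewrite /coef linear0 mul0mx mxE. Qed.

Lemma coef_sum i t (J : finType) (F : J -> M t) :
  coef i (\sum_j F j) = \sum_j coef i (F j).
Proof.
elim/big_rec2: _ => [|j x y _ <-]; first exact: coef0.
by rewrite coefD.
Qed.

Lemma coef_out i t (x : M t) : ~~ in_bar (I i) t -> coef i x = 0.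
Proof.
rewrite /coef; move: (dsum_proj i x); rewrite /= /ival_obj => v /negPf it.
by move: v; rewrite it => v; rewrite (thinmx0 v) mul0mx mxE.
Qed.

Lemma coef_neq0 i t (x : M t) : coef i x != 0 -> in_bar (I i) t.
Proof. by apply: contraNT => /(coef_out x) ->. Qed.

Lemma coef_gen i i' t : coef i' (gen i t) = ((i' == i) && in_bar (I i') t)%:R.
Proof.
rewrite /coef dsum_mkE; case: (in_bar (I i') t); last first.
  by rewrite (thinmx0 (_ *: _)) mul0mx mxE andbF.
by rewrite pid_mx_1 mulmx1 mxE mxE andbT mulr1n mulr1.
Qed.

Lemma coef_inj t (x y : M t) : (forall i, coef i x = coef i y) -> x = y.
Proof.
move=> xy; apply/dsumP => i; have := xy i; rewrite /coef.
move: (dsum_proj i x) (dsum_proj i y); rewrite /= /ival_obj.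
case: (in_bar (I i) t) => u v; last by rewrite (thinmx0 u) (thinmx0 v).
by rewrite pid_mx_1 !mulmx1 => uv; apply/rowP => j; rewrite !ord1.
Qed.

Lemma gen_decomp t (x : M t) : x = \sum_i coef i x *: gen i t.
Proof.
apply: coef_inj => i; rewrite coef_sum (bigD1 i) //= big1 => [|j ji].
  rewrite addr0 coefZ coef_gen eqxx /=; have [_|/(coef_out x) ->] := boolP (in_bar _ _).
    by rewrite mulr1.
  by rewrite mul0r.
by rewrite coefZ coef_gen eq_sym (negPf ji) mulr0.
Qed.

Lemma coef_pmap i s t (st : s <= t) (x : M s) :
  coef i (pmap M st x) = if in_bar (I i) t then coef i x else 0.
Proof.
case: ifP => [it|/negbT/coef_out ->] //.
rewrite /coef dsum_mkE /=; move: (dsum_proj i x); rewrite /= /ival_obj => v.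
rewrite it pid_mx_1 mulmx1.
by case: (in_bar (I i) s) v => v; rewrite ?pid_mx_1 // (thinmx0 v) !mul0mx.
Qed.

Lemma gen_pmap i s t (st : s <= t) : in_bar (I i) s ->
  pmap M st (gen i s) = gen i t.
Proof.
move=> si; apply: coef_inj => j; rewrite coef_pmap !coef_gen.
by case: (j =P i) => [->|_]; rewrite ?si; case: ifP.
Qed.
End IntervalSum.

(** * Matrices of an interleaving between bars *)

Section Matching.
Variables (k : fieldType) (R : realType).
Implicit Types (s t u : {nonneg R}) (a b c : bar R).

Section Cap.
Variables (e : {nonneg R}) (T : R).

(* Infinite deaths are replaced by a number T larger than everything else. *)
Definition cap b : R := if death b is r%:E then r else T.

(** The margin [2e] keeps shifted births below [T] and the cap of an infinite bar away from every
    finite death. *)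
Definition capped b : Prop := birth b + 2 * e%:num < T /\
  forall r, death b = r%:E -> r + 2 * e%:num < T.

Lemma in_barE b t : t%:num < T ->
  in_bar b t = (birth b <= t%:num < cap b).
Proof.
move=> tT; rewrite /in_bar /cap; case E: (death b) => [r||].
- by rewrite lte_fin.
- by rewrite tT ltry.
- by have := birth_lt_death b; rewrite E.
Qed.

Lemma cap_le b : capped b -> cap b <= T.
Proof.
have e0 : 0 <= e%:num by [].
case=> _ bT; rewrite /cap; case E: (death b) => [r||] //.
have := bT r E; lra.
Qed.

Lemma birth_lt_cap b : capped b -> birth b < cap b.
Proof.
have e0 : 0 <= e%:num by []; case=> bT _; rewrite /cap; have := birth_lt_death b.
by case: (death b) => [r||] // _; lra.
Qed.

Lemma cap_eq b : capped b -> cap b + 2 * e%:num < T \/ death b = +oo%E /\ cap b = T.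
Proof.
case=> _ bT; rewrite /cap; case E: (death b) => [r||]; [by left; apply: bT| by right|].
by have := birth_lt_death b; rewrite E.
Qed.

Definition ends_near a b : bool :=
  (`|birth a - birth b| <= e%:num) && (`|cap a - cap b| <= e%:num).

Definition long b : bool := 2 * e%:num < cap b - birth b.

Lemma ends_near_sym a b : ends_near a b = ends_near b a.
Proof. by rewrite /ends_near distrC (distrC (cap a)). Qed.

Lemma ends_nearE a b : ends_near a b = [&& birth a - birth b <= e%:num, birth b - birth a <= e%:num,
   cap a - cap b <= e%:num & cap b - cap a <= e%:num].
Proof.
by rewrite /ends_near !ler_norml -!andbA; apply/idP/idP => /and4P[? ? ? ?]; apply/and4P; split; lra.
Qed.

Section Maps.
Variables (n m : nat) (I : 'I_n -> bar R) (J : 'I_m -> bar R).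
Hypotheses (Icap : forall i, capped (I i)) (Jcap : forall j, capped (J j)).
Local Notation M := (psum (fun i => ival k (I i))).
Local Notation N := (psum (fun j => ival k (J j))).
Variables (f : shifted_maps e%:num M N).
Hypotheses (fn : shift_natural f).

Definition born b : {nonneg R} := NngNum (birth_ge0 b).
Definition later t : {nonneg R} := (t%:num + e%:num)%:nng.

Lemma later_ge t : t%:num + e%:num <= (later t)%:num. Proof. by []. Qed.

Definition mcoef i j : k := coef j (f (later_ge (born (I i))) (gen k I i (born (I i)))).

(** The first two bounds say that [J j] is alive at [birth (I i) + e]. If [J j] outlived [I i] by
    more than [e], the generator would be zero at [cap (I i)], hence its image zero [e] later, while
    coordinate [j] is still unchanged there. *)
Lemma mcoef_neq0 i j : mcoef i j != 0 ->
  [/\ birth (J j) <= birth (I i) + e%:num, birth (I i) + e%:num < cap (J j)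
    & cap (J j) <= cap (I i) + e%:num].
Proof.
have e0 : 0 <= e%:num by [].
set t0 := born (I i); move=> fij.
have [bT _] := Icap i.
have t1T : (later t0)%:num < T by rewrite /=; lra.
have := coef_neq0 fij.
rewrite in_barE // => /andP[/= b1 b2]; split=> //.
rewrite leNgt; apply: contra fij => IJ.
have [dI|[_ dI]] := cap_eq (Icap i); last by exfalso; have := cap_le (Jcap j); lra.
have s0 : 0 <= cap (I i).
  exact: le_trans (birth_ge0 _) (ltW (birth_lt_cap (Icap i))).
pose s : {nonneg R} := NngNum s0.
have t0s : t0 <= s by rewrite -num_le; exact: ltW (birth_lt_cap (Icap i)).
have t1u : later t0 <= later s by rewrite -num_le /= lerD2r.
have t0u : t0%:num + e%:num <= (later s)%:num by rewrite /= lerD2r.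
have E : pmap N t1u (f (later_ge t0) (gen k I i t0)) = 0.
  have -> : gen k I i t0 = pmap M (lexx t0) (gen k I i t0) by rewrite pmap_id.
  rewrite (fn _ _ _ t0u) -[f t0u _](fn t0s (lexx _) (later_ge s)) pmap_id.
  rewrite (_ : pmap M t0s _ = 0) ?linear0 //.
  apply: coef_inj => i'; rewrite coef_pmap coef0 coef_gen.
  case: ifP => // si'; case: eqP => //= ii'; move: si'; rewrite ii' in_barE //=.
    by rewrite ltxx andbF.
  by lra.
have := congr1 (@coef _ _ _ _ j _) E; rewrite coef_pmap coef0 in_barE //=; last by lra.
rewrite ifT; first by move=> E'; apply/eqP.
apply/andP; split=> //; apply: le_trans b1 _; rewrite lerD2r.
exact: t0s.
Qed.
End Maps.

Section Inverse.
Variables (n m : nat) (I : 'I_n -> bar R) (J : 'I_m -> bar R).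
Hypotheses (Icap : forall i, capped (I i)) (Jcap : forall j, capped (J j)).
Local Notation M := (psum (fun i => ival k (I i))).
Local Notation N := (psum (fun j => ival k (J j))).
Variables (f : shifted_maps e%:num M N) (g : shifted_maps e%:num N M).
Hypotheses (fn : shift_natural f) (gn : shift_natural g) (fg : shift_inverse f g).

(** Both sides are coordinate [i'] of the generator of [I i] moved by [2e]. Each [J j] with a
    nonzero entry is already born at [birth (I i) + e], and naturality of [g] moves the entry from
    its birth to that time. *)
Lemma mcoef_mul i i' : in_bar (I i') (later (later (born (I i)))) ->
  \sum_j mcoef f i j * mcoef g j i' = ((i' == i))%:R.
Proof.
set t0 := born (I i); set t1 := later t0; set t2 := later t1 => i't2.
have t02 : t0 <= t2.
  by rewrite -num_le /= -addrA lerDl addr_ge0.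
have t0I : in_bar (I i) t0 by rewrite /in_bar lexx /= birth_lt_death.
have := fg (later_ge t0) (later_ge t1) t02 (gen k I i t0).
rewrite (gen_pmap k (I := I)) // => /(congr1 (@coef _ _ _ _ i' _)).
rewrite coef_gen i't2 andbT => <-.
rewrite [f _ _]gen_decomp linear_sum coef_sum; apply: eq_bigr => j _.
rewrite linearZ coefZ -/(mcoef f i j).
have [->|fij] := eqVneq (mcoef f i j) 0; first by rewrite !mul0r.
congr (_ * _).
have jt1 : in_bar (J j) t1.
  exact: coef_neq0 fij.
have bt1 : born (J j) <= t1 by case/andP: jt1.
have jb : in_bar (J j) (born (J j)) by rewrite /in_bar lexx /= birth_lt_death.
rewrite -(gen_pmap k bt1 jb).
have h : (born (J j))%:num + e%:num <= t2%:num by rewrite /= lerD2r.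
have h' : later (born (J j)) <= t2 by rewrite -num_le /=.
rewrite -[g _ _]pmap_id (gn _ _ _ h) -(gn (lexx _) h' (later_ge _)) coef_pmap i't2.
by rewrite pmap_id.
Qed.

(* If J j were close to neither bar, birth + death would strictly decrease from
   I i to J j and from J j to I i'. *)
Lemma ends_near_or i i' j : birth (I i) + cap (I i) <= birth (I i') + cap (I i') ->
    mcoef f i j != 0 -> mcoef g j i' != 0 ->
  ends_near (I i) (J j) || ends_near (I i') (J j).
Proof.
have e0 : 0 <= e%:num by [].
move=> ii' /(mcoef_neq0 Icap Jcap fn)[f1 f2 f3] /(mcoef_neq0 Jcap Icap gn)[g1 g2 g3].
rewrite !ends_nearE; apply: contraT; rewrite negb_or => /andP[].
rewrite !negb_and -!ltNge => /or4P h1 /or4P h2.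
by case: h1; case: h2; lra.
Qed.

(** Apply [unitriangular_card] in the order of birth plus death; by [ends_near_or] the sum
    restricted to the neighbours of [S] loses no term. *)
Lemma long_neighbours (S : {set 'I_n}) : (forall i, i \in S -> long (I i)) ->
  (#|S| <= #|[set j | [exists i in S, ends_near (I i) (J j)]]|)%N.
Proof.
have e0 : 0 <= e%:num by [].
move=> Slong; set mu := [set j | _].
apply: (unitriangular_card (F := k) (f := mcoef f) (g := mcoef g)
  (alpha := fun i => birth (I i) + cap (I i))) => i i' iS i'S ii'.
have muP j : j \notin mu -> mcoef f i j * mcoef g j i' = 0.
  rewrite inE => /exists_inPn jmu; apply/eqP; rewrite mulf_eq0.
  apply: contraT; rewrite negb_or => /andP[fij gji].
  by case/orP: (ends_near_or ii' fij gji) => h; [have := jmu i iS | have := jmu i' i'S];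
    rewrite h.
have -> : \sum_(j in mu) mcoef f i j * mcoef g j i' = \sum_j mcoef f i j * mcoef g j i'.
  rewrite [RHS](bigID (mem mu)) /= [X in _ + X]big1 ?addr0 // => j; exact: muP.
rewrite eq_sym; have li := Slong i iS; have li' := Slong i' i'S.
have [bT _] := Icap i; rewrite /long in li li'.
have [h|h] := boolP (in_bar (I i') (later (later (born (I i))))); first exact: mcoef_mul.
move: h; rewrite in_barE //=; last by lra.
rewrite negb_and -ltNge -leNgt => h.
have [E|_] := eqVneq i' i; first by exfalso; move: h; rewrite E => /orP[]; lra.
(* If [I i'] is born after [birth (I i) + 2e], no product is nonzero. If it is dead by then, lengths
   above [2e] make it both start and end before [I i], against [ii']. *)
rewrite big1 // => j _; apply/eqP; rewrite mulf_eq0; apply: contraT.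
rewrite negb_or => /andP[].
move=> /(mcoef_neq0 Icap Jcap fn)[f1 f2 f3] /(mcoef_neq0 Jcap Icap gn)[g1 g2 g3].
by exfalso; case/orP: h; lra.
Qed.
End Inverse.
End Cap.
End Matching.

(** * Marriage condition for padded sets *)

Lemma card_sum_set (A B : finType) (S : {set A + B}) :
  #|S| = (#|[set a | inl a \in S]| + #|[set b | inr b \in S]|)%N.
Proof.
rewrite -!sum1_card big_sumType /=.
by congr addn; apply: eq_bigl => x; rewrite inE.
Qed.

Section PaddedMatching.
Variables (A B : finType) (ends_near : A -> B -> bool) (longA : pred A) (longB : pred B).

(** The [inr] elements are the empty intervals used for padding; only bars that are not long may be
    matched to them. *)
Definition padded_edge (x : A + B) (y : B + A) : bool :=
  match x, y with
  | inl a, inl b => ends_near a b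
  | inl a, inr _ => ~~ longA a
  | inr _, inl b => ~~ longB b
  | inr _, inr _ => true
  end.

Hypothesis hallA : forall S : {set A}, (forall a, a \in S -> longA a) ->
  (#|S| <= #|[set b | [exists a in S, ends_near a b]]|)%N.
Hypothesis hallB : forall S : {set B}, (forall b, b \in S -> longB b) ->
  (#|S| <= #|[set a | [exists b in S, ends_near a b]]|)%N.

Lemma padded_matching :
  exists2 f : A + B -> B + A, injective f & forall x, padded_edge x (f x).
Proof.
have [|f fI fP] := @hall_marriage _ _ (fun x => [set y | padded_edge x y]); last first.
  by exists f => // x; have := fP x; rewrite inE.
move=> S; set NS := \bigcup_(x in S) _.
have NSP x y : x \in S -> padded_edge x y -> y \in NS.
  by move=> xS xy; apply/bigcupP; exists x => //; rewrite inE.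
pose SA := [set a | inl a \in S]; pose SB := [set b | inr b \in S].
have NSA : [set b | [exists a in SA, ends_near a b]] \subset [set b | inl b \in NS].
  apply/fintype.subsetP => b; rewrite !inE => /exists_inP[a aS ab].
  by apply: (NSP (inl a)) => //; rewrite inE in aS.
rewrite !card_sum_set -/SA -/SB.
(* An empty interval in [S] is adjacent to all empty intervals and all short bars opposite. The bars
   [L] missed by [S] are therefore long, their neighbours avoid [SA], and [hallB] bounds their
   number by that of the complement of [SA]. *)
have [b0|SB0] := pickP (mem SB).
  rewrite /= inE => b0S.
  have dummies : [set a | inr a \in NS] = finset.setT.
    by apply/setP => a; rewrite !inE; apply/idP; apply: NSP b0S _.
  set L := ~: [set b | inl b \in NS].
  have Llong b : b \in L -> longB b.
    rewrite !inE; apply: contraR => bs; exact: NSP b0S _.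
  have LA : [set a | [exists b in L, ends_near a b]] \subset ~: SA.
    apply/fintype.subsetP => a; rewrite !inE => /exists_inP[b bL ab].
    apply/negP => aS; move: bL; rewrite !inE => /negP; apply.
    by apply: NSP aS _.
  have := leq_trans (hallB Llong) (subset_leq_card LA).
  have cL := cardsC [set b | inl b \in NS]; have cA := cardsC SA.
  rewrite dummies cardsT -cA => LSA.
  rewrite addnCA leq_add2l; apply: leq_trans (max_card _) _.
  by rewrite -cL leq_add2l.
have -> : #|SB| = 0%N.
  by apply/eqP; rewrite cards_eq0; apply/eqP/setP => b; rewrite [RHS]inE; exact: SB0.
rewrite addn0.
(* A short bar is adjacent to all [#|A|] empty intervals opposite, which suffices as [S] now lies in
   [A]. *)
have [a0 /andP[]|Slong] := pickP (fun a => (a \in SA) && ~~ longA a).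
  rewrite inE => a0S a0s; have -> : [set a | inr a \in NS] = finset.setT.
    by apply/setP => a; rewrite !inE; apply/idP; apply: NSP a0S _.
  by rewrite cardsT; apply: leq_trans (max_card _) (leq_addl _ _).
apply: leq_trans (hallA _) (leq_trans (subset_leq_card NSA) (leq_addr _ _)).
by move=> a aS; have := Slong a; rewrite aS => /negbFE.
Qed.
End PaddedMatching.

(** * Bottleneck bound from an interleaving *)

Section Stability.
Variables (k : fieldType) (R : realType).

Lemma exists_cap (e : {nonneg R}) (A : finType) (b : A -> bar R) :
  exists T, forall a, capped e T (b a).
Proof.
pose w a := birth (b a) + `|fine (death (b a))| + 2 * e%:num.
have e0 : 0 <= e%:num by [].
have w0 a : 0 <= w a.
  by have := birth_ge0 (b a); have := normr_ge0 (fine (death (b a))); rewrite /w; lra.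
exists (1 + \sum_a w a) => a.
have wT : w a < 1 + \sum_a w a.
  rewrite (bigD1 a) //=; have : 0 <= \sum_(i | i != a) w i by apply: sumr_ge0.
  by lra.
have b0 := birth_ge0 (b a); have f0 := normr_ge0 (fine (death (b a))).
split=> [|r E]; rewrite /w in wT; first by lra.
move: wT; rewrite E /=; have := ler_norm r; lra.
Qed.

Section Costs.
Variables (e : {nonneg R}) (T : R).
Implicit Types a b : bar R.

(** A finite and an infinite bar are never near, since [T] exceeds finite deaths by more than
    [2e]. *)
Lemma ends_near_cost a b : capped e T a -> capped e T b -> ends_near e T a b ->
  (bar_cost a b <= e%:num%:E)%E.
Proof.
have e0 : 0 <= e%:num by [].
move=> aT bT /andP[ab]; rewrite distrC in ab; rewrite distrC ler_norml.
have := birth_lt_death a; have := birth_lt_death b.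
case: aT => _; case: bT => _; rewrite /cap /bar_cost.
case: (death a) => [r||] //; case: (death b) => [r'||] // bT aT _ _ => /andP[h1 h2].
- by rewrite lee_fin ge_max ab ler_norml h1 h2.
- by exfalso; have := aT r erefl; lra.
- by exfalso; have := bT r' erefl; lra.
Qed.

Lemma short_cost a : capped e T a -> ~~ long e T a -> (bar_cost0 a <= e%:num%:E)%E.
Proof.
have e0 : 0 <= e%:num by [].
move=> [aT _]; rewrite /long -leNgt /cap /bar_cost0; have := birth_lt_death a.
case: (death a) => [r||] // _ h; last by exfalso; lra.
by rewrite lee_fin; lra.
Qed.
End Costs.

Lemma size_pad (B B' : seq (bar R)) : size (pad B B') = (size B + size B')%N.
Proof. by rewrite size_cat size_map size_nseq. Qed.

Lemma tnth_pad (B B' : seq (bar R)) (i : 'I_(size (pad B B'))) :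
  tnth (in_tuple (pad B B')) i =
  match split (cast_ord (size_pad B B') i) with
  | inl i' => Some (tnth (in_tuple B) i')
  | inr _ => None
  end.
Proof.
rewrite (tnth_nth None) /= /pad nth_cat size_map.
case: splitP => j /= ->.
  set b := tnth (in_tuple B) j.
  by rewrite ltn_ord (nth_map b) //; rewrite [in RHS]/b (tnth_nth b).
by rewrite ltnNge leq_addr /= nth_nseq if_same.
Qed.

Lemma bottleneck_interleaved (e : {nonneg R}) (B B' : seq (bar R)) :
  interleaved e%:num
    (psum (fun i : 'I_(size B) => ival k (tnth (in_tuple B) i)))
    (psum (fun i : 'I_(size B') => ival k (tnth (in_tuple B') i))) ->
  (bottleneck B B' <= e%:num%:E)%E.
Proof.
move=> [f [g [fn gn fg gf]]].
set I := tnth (in_tuple B); set J := tnth (in_tuple B').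
have [T capT] := exists_cap e
  (fun x : 'I_(size B) + 'I_(size B') => match x with inl i => I i | inr j => J j end).
have IT i : capped e T (I i) := capT (inl i).
have JT j : capped e T (J j) := capT (inr j).
have hB S := @long_neighbours k R e T _ _ I J IT JT f g fn gn fg S.
have hB' (S : {set 'I_(size B')}) : (forall j, j \in S -> long e T (J j)) ->
    (#|S| <= #|[set i | [exists j in S, ends_near e T (I i) (J j)]]|)%N.
  move=> Sl; apply: leq_trans (long_neighbours JT IT gn fn gf Sl) _.
  apply/subset_leq_card/fintype.subsetP => i; rewrite !inE => /exists_inP[j jS ij].
  by apply/exists_inP; exists j => //; rewrite ends_near_sym.
have [h hI hP] := padded_matching hB hB'.
(* Positions in a padded sequence are identified with the disjoint union of bars and empty intervals
   by [split]. *)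
pose theta := [ffun i : 'I_(size (pad B B')) => cast_ord (esym (size_pad B' B))
  (unsplit (h (split (cast_ord (size_pad B B') i))))].
have theta_inj : injective theta.
  move=> i i'; rewrite !ffunE => /cast_ord_inj/(can_inj unsplitK)/hI.
  by move/(can_inj splitK)/cast_ord_inj.
apply: (@bigmin_inf _ _ _ _ theta).
  apply/asboolP; apply: inj_card_bij theta_inj _.
  by rewrite !card_ord !size_pad addnC.
apply/bigmax_leP; split=> [|i _]; first by rewrite lee_fin.
rewrite !tnth_pad ffunE cast_ordKV unsplitK.
have := hP (split (cast_ord (size_pad B B') i)).
case: (split _) => [i1|j1]; case: (h _) => [j2|i2] //=.
- exact: ends_near_cost.
- exact: short_cost.
- exact: short_cost.
Qed.
End Stability.

(** * Hausdorff distance and correspondences *)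

Section GromovHausdorffBound.
Local Open Scope ereal_scope.

Lemma hausdorff_ge0 (R : realType) (Z : Type) (d : pseudo_metric R Z) (A B : set Z) :
  (exists a, A a) -> 0 <= hausdorff d A B.
Proof.
move=> [a Aa]; rewrite /hausdorff le_max; apply/orP; left.
apply: le_trans (ereal_sup_ubound _); last by exists a.
by apply/le_ereal_inf_tmp => _ [b _ <-]; rewrite lee_fin pdist_ge0.
Qed.

(* The infimum over a finite set of points is attained. *)
Lemma hausdorff_near (R : realType) (X Y : finType) (Z : Type) (d : pseudo_metric R Z)
    (f : X -> Z) (g : Y -> Z) (r : R) :
    hausdorff d (range f) (range g) <= r%:E ->
  (0 < #|X|)%N -> (0 < #|Y|)%N ->
  (forall x, exists y, (d (f x) (g y) <= r)%R) /\
  (forall y, exists x, (d (f x) (g y) <= r)%R).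
Proof.
rewrite /hausdorff ge_max => /andP[fr gr] /card_gt0P[x0 _] /card_gt0P[y0 _].
split=> [x|y].
  pose y := [arg min_(y < y0) d (f x) (g y)]%O; exists y.
  rewrite -lee_fin; apply: le_trans fr.
  apply: le_trans (ereal_sup_ubound _); last by exists (f x); [exists x|].
  apply/le_ereal_inf_tmp => _ [_ [y' _ <-] <-]; rewrite lee_fin /y.
  by case: arg_minP => // y1 _; apply.
pose x := [arg min_(x < x0) d (f x) (g y)]%O; exists x.
rewrite -lee_fin; apply: le_trans gr.
apply: le_trans (ereal_sup_ubound _); last by exists (g y); [exists y|].
apply/le_ereal_inf_tmp => _ [_ [x' _ <-] <-]; rewrite lee_fin /x.
by case: arg_minP => // x1 _; apply.
Qed.
End GromovHausdorffBound.

Theorem corollary4p24 (k : fieldType) (R : realType)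
  (dispX dispY : Order.disp_t) (X : finOrderType dispX) (Y : finOrderType dispY)
  (X_gt0 : (0 < #|X|)%N) (Y_gt0 : (0 < #|Y|)%N)
  (dX : pseudo_metric R X) (dY : pseudo_metric R Y) (BX BY : seq (bar R)) :
  is_barcode (PHHZ k dX) BX -> is_barcode (PHHZ k dY) BY ->
  (bottleneck BX BY <= 2%:E * gromov_hausdorff dX dY)%E.
Proof.
move=> barX barY.
(* Each common embedding is bounded separately, so the infimum need not be attained. The pairs at
   distance at most [r] form a correspondence, of distortion at most [2r] by the triangle
   inequality. *)
have bound (r : R) : (exists (Z : Type) (dZ : pseudo_metric R Z) (f : X -> Z) (g : Y -> Z),
    [/\ isometric dX dZ f, isometric dY dZ g
      & r%:E = hausdorff dZ (range f) (range g)]) -> (bottleneck BX BY <= (2 * r)%:E)%E.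
  move=> [Z [dZ [f [g [fI gI rE]]]]].
  have [x0 _] := card_gt0P X_gt0.
  have r0 : 0 <= r by rewrite -lee_fin rE hausdorff_ge0 //; exists (f x0), x0.
  have hr : (hausdorff dZ (range f) (range g) <= r%:E)%E by rewrite rE.
  have [fr gr] := @hausdorff_near R X Y Z dZ f g r hr X_gt0 Y_gt0.
  have r2 : 0 <= 2 * r by rewrite mulr_ge0.
  apply: (@bottleneck_interleaved k R (NngNum r2)).
  apply: interleaved_iso barX barY _.
  pose C := [set xy : X * Y | dZ (f xy.1) (g xy.2) <= r]%SET.
  apply: (@PHHZ_interleaved k R _ _ X Y dX dY C) => //.
  - by move=> x; have [y xy] := fr x; exists y; rewrite inE.
  - by move=> y; have [x xy] := gr y; exists x; rewrite inE.
  move=> [x y] [x' y']; rewrite !inE /= -fI -gI => xy xy'.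
  have := pdist_triangle dZ (f x) (g y) (f x').
  have := pdist_triangle dZ (g y) (g y') (f x').
  have := pdist_triangle dZ (g y) (f x) (g y').
  have := pdist_triangle dZ (f x) (f x') (g y').
  rewrite (pdist_sym dZ (g y) (f x)) (pdist_sym dZ (g y') (f x')).
  by rewrite ler_norml => *; apply/andP; split; lra.
(* Moving the factor 2 across makes the left side a lower bound to be tested on each embedding. *)
rewrite -lee_pdivrMl //; apply/le_ereal_inf_tmp => _ [Z [dZ [f [g [fI gI ->]]]]].
rewrite lee_pdivrMl //; case E: hausdorff => [r||].
- by rewrite -EFinM; apply: bound; exists Z, dZ, f, g.
- by rewrite mulry gtr0_sg // mul1e leey.
have [x0 _] := card_gt0P X_gt0.
have : (0 <= hausdorff dZ (range f) (range g))%E.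
  by apply: hausdorff_ge0; exists (f x0), x0.
by rewrite E.
Qed.
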